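(* Let $f:M\to\mathbb{R}^4$ be isothermic with associated family $\mathrm{d}_\lambda=d+\lambda\eta$, $\lambda\in\mathbb{C}$. Let $\varrho\in\mathbb{C}\setminus\{0\}$ and let $\varphi$ be a $\mathrm{d}_\varrho$-parallel section on $\tilde M$. Put $E=\varphi\mathbb{C}$, let $\tilde L=\psi\mathbb{H}$ be the line bundle of $f$ over $\tilde M$, and assume that $\tilde M\times\mathbb{C}^4=E\oplus Ej\oplus\tilde L$. Denote by $\pi_E,\pi_{Ej},\pi_L$ the projections along this splitting, and let $$r_\lambda=r^E_\varrho(\lambda)=\pi_E\,\gamma_\varrho(\lambda)+\pi_{Ej}+\pi_L\,\sigma_\varrho(\lambda),\qquad \gamma_\varrho(\lambda)=\frac{\bar\varrho(\varrho-\lambda)}{\varrho(\bar\varrho-\lambda)},\quad \sigma_\varrho(\lambda)=\frac{\bar\varrho}{\bar\varrho-\lambda},$$ where the complex numbers act by right multiplication. Then the Darboux transform $\hat f=D_{\varphi,\varrho}(f)$ is given by a simple factor dressing with dressing matrix $r_\lambda$, that is, the line bundle of $\hat f$ is $r^E_\varrho(\infty)(\tilde M\times\mathbb{C}^4)$ and the associated family of $\hat f$ is given by $\hat{\mathrm{d}}_\lambda=r_\lambda\cdot\mathrm{d}_\lambda$. Moreover, $\hat{\mathrm{d}}_\lambda=d+\lambda\hat\eta$ where $$\hat\eta=-\Big(\pi_E\circ d\circ\pi_L\,\frac1\varrho+\pi_{Ej}\circ d\circ\pi_L\,\frac1{\bar\varrho}\Big).$$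
   Context: $\mathbb{H}=\mathrm{span}_{\mathbb{R}}\{1,i,j,k\}=\mathbb{R}^4$, $\mathbb{C}=\mathrm{span}_{\mathbb{R}}\{1,i\}$; $\mathbb{H}^2=\mathbb{C}^4$ with complex scalars acting by right multiplication. $M$ is a Riemann surface with universal cover $\tilde M$. A (possibly branched) conformal immersion $f:M\to\mathbb{R}^4$ is isothermic if there is a branched conformal immersion $f^d:\tilde M\to\mathbb{R}^4$ (a dual surface) with $df\wedge df^d=df^d\wedge df=0$; round spheres are excluded. Fix $f^d$. Put $e=\begin{pmatrix}1\\0\end{pmatrix}$, $\psi=\begin{pmatrix}f\\1\end{pmatrix}$. The line bundle of $f$ is $L=\psi\mathbb{H}$; maps into $\mathbb{HP}^1$ are identified with quaternionic line subbundles of the trivial $\mathbb{H}^2$-bundle. The associated family of $f$ is the family of flat connections $\mathrm{d}_\lambda\varphi=d\varphi+\eta\varphi\lambda$, $\lambda\in\mathbb{C}$, on the trivial $\mathbb{C}^4$-bundle, with $\eta=\begin{pmatrix} f\,df^d & -f\,df^d f\\ df^d&-df^d f\end{pmatrix}$. Here $\eta$ is a retraction form ($\eta\wedge\eta=0$ with $\eta^2=0$, $d\eta=0$) and $\mathrm{im}\,\eta\subset L\subset\ker\eta$; conversely a non-trivial closed $\mathrm{End}(\mathbb{H}^2)$-valued 1-form $\eta$ with $\eta^2=0$ and $\mathrm{im}\,\eta\subset L\subset\ker\eta$ for the line bundle $L$ of a surface determines an associated family $d+\lambda\eta$ of that (isothermic) surface. The section $\varphi=e\alpha+\psi\beta$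 is $\mathrm{d}_\varrho$-parallel iff $d\alpha=-df\,\beta$, $d\beta=-df^d\,\alpha\varrho$; the $\varrho$-Darboux transform $D_{\varphi,\varrho}(f)$ is the surface with line bundle $\varphi\mathbb{H}$, i.e. with affine coordinate $f+\alpha\beta^{-1}$. Gauge action: $r\cdot\nabla=r\circ\nabla\circ r^{-1}$; the map $\lambda\mapsto r_\lambda\cdot \mathrm{d}_\lambda$ is understood as extended across $\lambda=\varrho,\bar\varrho$. $r^E_\varrho(\infty)=\lim_{\lambda\to\infty}r^E_\varrho(\lambda)$. *)

(* Defs.v *)
From HB Require Import structures.
From mathcomp Require Import all_boot all_order all_algebra.
From mathcomp Require Import complex.
From mathcomp Require Import all_classical all_reals all_analysis.
From mathcomp Require Import ring.
Import numFieldNormedType.Exports.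

Set Implicit Arguments.
Unset Strict Implicit.
Unset Printing Implicit Defensive.

Import Order.TTheory GRing.Theory Num.Theory.
Local Open Scope classical_set_scope.
Local Open Scope ring_scope.

(* An alias of [R[i]] at which the topology of a numClosedFieldType is found
   by unification. *)
Definition cplx (R : realType) : numClosedFieldType := complex R.

(* coordinates with respect to the basis 1, i, j, k *)
Definition quat (R : realType) := 'rV[R]_4.

HB.instance Definition _ (R : realType) := NormedModule.copy (quat R) 'rV[R]_4.

Section Quaternions.
Variable R : realType.
Implicit Types p q r : quat R.

Definition mkq (a b c d : R) : quat R := \row_(n < 4) nth 0 [:: a; b; c; d] n.

Definition qone : quat R := mkq 1 0 0 0.
Definition qj : quat R := mkq 0 0 1 0.

Definition qmul p q : quat R :=
  let a n := (p : 'rV_4) ord0 n in let b n := (q : 'rV_4) ord0 n in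
  mkq (a 0 * b 0 - a 1 * b 1 - a 2 * b 2 - a 3 * b 3)
      (a 0 * b 1 + a 1 * b 0 + a 2 * b 3 - a 3 * b 2)
      (a 0 * b 2 - a 1 * b 3 + a 2 * b 0 + a 3 * b 1)
      (a 0 * b 3 + a 1 * b 2 - a 2 * b 1 + a 3 * b 0).

Lemma mkqE (a b c d : R) : ((mkq a b c d : 'rV_4) ord0 0 = a) *
  ((mkq a b c d : 'rV_4) ord0 1 = b) * ((mkq a b c d : 'rV_4) ord0 2 = c) *
  ((mkq a b c d : 'rV_4) ord0 3 = d).
Proof. by rewrite !mxE. Qed.

Lemma quatP p q :
  (p : 'rV_4) ord0 0 = (q : 'rV_4) ord0 0 ->
  (p : 'rV_4) ord0 1 = (q : 'rV_4) ord0 1 ->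
  (p : 'rV_4) ord0 2 = (q : 'rV_4) ord0 2 ->
  (p : 'rV_4) ord0 3 = (q : 'rV_4) ord0 3 -> p = q.
Proof.
move=> h0 h1 h2 h3; apply/rowP => n.
by case: n => [[|[|[|[|n]]]]] //= hn;
  [move: h0|move: h1|move: h2|move: h3]; congr (_ = _); congr (fun_of_matrix _ _ _);
  apply/val_inj.
Qed.

Lemma qmulA : associative qmul.
Proof. by move=> p q r; apply: quatP; rewrite /qmul !mkqE; ring. Qed.

Lemma qmul1q : left_id qone qmul.
Proof. by move=> p; apply: quatP; rewrite /qmul /qone !mkqE; ring. Qed.

Lemma qmulq1 : right_id qone qmul.
Proof. by move=> p; apply: quatP; rewrite /qmul /qone !mkqE; ring. Qed.

Lemma qmulDl : left_distributive qmul +%R.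
Proof.
by move=> p q r; apply: quatP; rewrite /qmul [in RHS]mxE !mkqE !mxE; ring.
Qed.

Lemma qmulDr : right_distributive qmul +%R.
Proof.
by move=> p q r; apply: quatP; rewrite /qmul [in RHS]mxE !mkqE !mxE; ring.
Qed.

Lemma qone_neq0 : qone != 0.
Proof.
by apply/eqP => /(congr1 (fun q : quat R => (q : 'rV_4) ord0 0));
  rewrite !mxE /=; apply/eqP; rewrite oner_eq0.
Qed.

End Quaternions.

HB.instance Definition _ (R : realType) := GRing.Zmodule_isNzRing.Build (quat R)
  (@qmulA R) (@qmul1q R) (@qmulq1 R) (@qmulDl R) (@qmulDr R) (@qone_neq0 R).

Notation quat2 R := (quat R * quat R)%type.

Section QuaternionicPlane.
Variable R : realType.

Definition c2q (z : cplx R) : quat R := mkq (complex.Re z) (complex.Im z) 0 0.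

(* right multiplication, by which quaternions and complex numbers act *)
Definition rmul (v : quat2 R) (q : quat R) : quat2 R := (v.1 * q, v.2 * q).

Definition quat_line (v : quat2 R) : set (quat2 R) := range (rmul v).

Definition complex_line (v : quat2 R) : set (quat2 R) :=
  range (rmul v \o c2q).

Definition times_j (A : set (quat2 R)) : set (quat2 R) :=
  [set rmul v (qj R) | v in A].

Definition set_add (A B : set (quat2 R)) : set (quat2 R) :=
  [set a + b | a in A & b in B].

Definition direct_sum3 (A B C : set (quat2 R)) : Prop :=
  forall v : quat2 R, exists! t : quat2 R * quat2 R * quat2 R,
    [/\ A t.1.1, B t.1.2, C t.2 & v = t.1.1 + t.1.2 + t.2].

(* projection onto [A] along [B]; meaningful when A and B are complementary *)
Definition proj_along (A B : set (quat2 R)) (v : quat2 R) : quat2 R :=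
  xget 0 [set a | A a /\ B (v - a)].

Definition dot n (u v : 'rV[R]_n) : R := \sum_(k < n) u ord0 k * v ord0 k.

(* neighbourhoods of the point at infinity of the complex plane *)
Definition cinfty : set_system (cplx R) :=
  [set A | exists r : R, forall z : cplx R, r%:C%C < `|z| -> A z].

End QuaternionicPlane.

Notation plane R := 'rV[R]_2.

Section Smooth.
Variables (R : realType) (V : normedModType R).

Fixpoint Ck (k : nat) (U : set (plane R)) (g : plane R -> V) : Prop :=
  if k is k'.+1 then
    (forall x, U x -> differentiable g x) /\
    (forall v, Ck k' U (fun x => 'D_v g x))
  else forall x, U x -> {for x, continuous g}.

Definition smooth_plane (U : set (plane R)) (g : plane R -> V) : Prop :=
  forall k, Ck k U g.

End Smooth.

(* multiplication by i under the identification of the plane with C *)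
Definition rot (R : realType) (X : plane R) : plane R :=
  \row_(k < 2) (if k == 0 then - X ord0 1 else X ord0 0).

(* complex differentiability; that the map is smooth is automatic (Goursat) *)
Definition holomorphic_plane (R : realType) (U : set (plane R))
    (g : plane R -> plane R) : Prop :=
  smooth_plane U g /\
  forall x X, U x -> 'D_(rot X) g x = rot ('D_X g x).

(* [coord] and [param] are mutually inverse between [dom] and its image; their
   values elsewhere are irrelevant. *)
Record chart (R : realType) (T : topologicalType) := Chart {
  dom : set T;
  coord : T -> plane R;
  param : plane R -> T
}.

Definition chart_image (R : realType) (T : topologicalType) (c : chart R T) :
  set (plane R) := coord c @` dom c.

Record is_chart (R : realType) (T : topologicalType) (c : chart R T) : Prop := {
  dom_open : open (dom c);
  chart_image_open : open (chart_image c);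
  coord_continuous : {within dom c, continuous (coord c)};
  param_continuous : {within chart_image c, continuous (param c)};
  coordK : forall x, dom c x -> param c (coord c x) = x
}.

Record riemann_surface (R : realType) := RiemannSurface {
  rs_space :> topologicalType;
  atlas : set (chart R rs_space);
  rs_nonempty : [set: rs_space] !=set0;
  rs_connected : connected [set: rs_space];
  rs_hausdorff : hausdorff_space rs_space;
  atlas_chart : forall c, atlas c -> is_chart c;
  atlas_cover : forall x, exists2 c, atlas c & dom c x;
  atlas_holomorphic : forall c c', atlas c -> atlas c' ->
    holomorphic_plane (coord c @` (dom c `&` dom c')) (coord c' \o param c)
}.

Section Maps.
Variable R : realType.
Implicit Types S T : riemann_surface R.

Definition holomorphic_on S T (U : set S) (h : S -> T) : Prop :=
  (forall x, U x -> {for x, continuous h}) /\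
  forall c c', atlas c -> atlas c' ->
    holomorphic_plane (coord c @` (dom c `&` U `&` h @^-1` dom c'))
                      (coord c' \o h \o param c).

Definition simply_connected (X : topologicalType) : Prop :=
  forall g : R -> X, {within `[0, 1], continuous g} -> g 0 = g 1 ->
  exists H : R * R -> X,
    [/\ {within `[0, 1] `*` `[0, 1], continuous H},
        forall t, t \in `[0, 1] -> H (0, t) = g t,
        forall t, t \in `[0, 1] -> H (1, t) = g 0 &
        forall s, s \in `[0, 1] -> H (s, 0) = g 0 /\ H (s, 1) = g 0].

(* The sheets are mapped biholomorphically: the complex structure of the
   covering surface is the one lifted from [T]. *)
Definition holomorphic_covering S T (cov : S -> T) : Prop :=
  set_surj setT setT cov /\
  forall y : T, exists V : set T, exists I : Type, exists U : I -> set S,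
    [/\ open V, V y, (forall n, open (U n)),
        trivIset setT U &
        cov @^-1` V = \bigcup_n U n /\
        forall n, [/\ set_bij (U n) V cov, holomorphic_on (U n) cov &
          exists h : T -> S, holomorphic_on V h /\
            forall x, U n x -> h (cov x) = x]].

Definition universal_cover S T (cov : S -> T) : Prop :=
  holomorphic_covering cov /\ simply_connected S.

Definition smooth_on S (V : normedModType R) (U : set S) (s : S -> V) : Prop :=
  forall c, atlas c -> smooth_plane (coord c @` (dom c `&` U)) (s \o param c).

(* A [V]-valued 1-form, given in each chart: [omega c x X] is its value at [x]
   on the tangent vector with components [X] in the chart [c]. Only the values
   for [c] in the atlas and [x] in its domain are meaningful. *)
Definition form S (V : Type) := chart R S -> S -> plane R -> V.

Definition eq_form S V (omega omega' : form S V) : Prop :=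
  forall c x X, atlas c -> dom c x -> omega c x X = omega' c x X.

Definition is_form S (V : normedModType R) (omega : form S V) : Prop :=
  [/\ forall c x X Y (a : R), atlas c -> dom c x ->
        omega c x (a *: X + Y) = a *: omega c x X + omega c x Y,
      forall c c' x X, atlas c -> atlas c' -> dom c x -> dom c' x ->
        omega c' x ('D_X (coord c' \o param c) (coord c x)) = omega c x X &
      forall c X, atlas c ->
        smooth_plane (chart_image c) (fun u => omega c (param c u) X)].

(* the vanishing of d omega (X, Y) on coordinate vector fields X, Y *)
Definition closed_form S (V : normedModType R) (omega : form S V) : Prop :=
  forall c x X Y, atlas c -> dom c x ->
    'D_X (fun u => omega c (param c u) Y) (coord c x) =
    'D_Y (fun u => omega c (param c u) X) (coord c x).

Definition dform S (V : normedModType R) (s : S -> V) : form S V :=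
  fun c x X => 'D_X (s \o param c) (coord c x).

Definition wedge S (omega theta : form S (quat R)) (c : chart R S) (x : S)
    (X Y : plane R) : quat R :=
  omega c x X * theta c x Y - omega c x Y * theta c x X.

Definition wedge_eq0 S (omega theta : form S (quat R)) : Prop :=
  forall c x X Y, atlas c -> dom c x -> wedge omega theta c x X Y = 0.

Definition conformal_immersion_at S (g : S -> quat R) (x : S) : Prop :=
  forall c, atlas c -> dom c x -> exists2 r : R, 0 < r &
    forall X Y, dot (dform g c x X) (dform g c x Y) = r * dot X Y.

(* At the excluded isolated points the differential is conformal or, at a
   branch point, zero, by continuity. *)
Definition branched_conformal_on S (U : set S) (g : S -> quat R) : Prop :=
  smooth_on U g /\
  forall x, U x -> \forall y \near x^', U y -> conformal_immersion_at g y.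

Definition branched_conformal S (g : S -> quat R) : Prop :=
  branched_conformal_on setT g.

(* the image lies in a round 2-sphere of R^4 *)
Definition round_sphere S (g : S -> quat R) : Prop :=
  exists a n : quat R, exists2 r : R, 0 < r & n != 0 /\
    forall x, dot (g x - a) (g x - a) = r ^+ 2 /\ dot (g x - a) n = 0.

Definition dual_surface S T (cov : S -> T) (f : T -> quat R) (fd : S -> quat R) :
    Prop :=
  [/\ branched_conformal fd, wedge_eq0 (dform (f \o cov)) (dform fd) &
      wedge_eq0 (dform fd) (dform (f \o cov))].

Definition isothermic S T (cov : S -> T) (f : T -> quat R) : Prop :=
  [/\ branched_conformal f, ~ round_sphere f & exists fd, dual_surface cov f fd].

Definition psi S (f : S -> quat R) (x : S) : quat2 R := (f x, 1).

Definition line_bundle S (f : S -> quat R) (x : S) : set (quat2 R) :=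
  quat_line (psi f x).

(* A map into HP^1, given by its line bundle, is a branched conformal immersion
   if it is one in the affine coordinates (x, 1)H |-> x and (1, x)H |-> x. *)
Definition surface_HP1 S (L : S -> set (quat2 R)) : Prop :=
  forall x, exists U : set S, exists g : S -> quat R,
    [/\ open U, U x, branched_conformal_on U g &
        (forall y, U y -> L y = quat_line (g y, 1)) \/
        (forall y, U y -> L y = quat_line (1, g y))].

Definition connection S := (S -> quat2 R) -> form S (quat2 R).

(* forms with values in the (pointwise, possibly only real linear) maps of H^2 *)
Definition end_form S := form S (quat2 R -> quat2 R).

Definition assoc_form S (f fd : S -> quat R) : end_form S :=
  fun c x X v => let w := dform fd c x X in
    (f x * w * v.1 - f x * w * f x * v.2, w * v.1 - w * f x * v.2).

Definition assoc_family S (eta : end_form S) (lambda : cplx R) : connection S :=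
  fun s c x X => dform s c x X + rmul (eta c x X (s x)) (c2q lambda).

Definition parallel S (nabla : connection S) (s : S -> quat2 R) : Prop :=
  smooth_on setT s /\ eq_form (nabla s) (fun _ _ _ => 0).

Definition retraction_form S (eta : end_form S) : Prop :=
  [/\ forall c x X v w (q : quat R), atlas c -> dom c x ->
        eta c x X (rmul v q + w) = rmul (eta c x X v) q + eta c x X w,
      forall v, is_form (fun c x X => eta c x X v),
      forall v, closed_form (fun c x X => eta c x X v) &
      forall c x X Y v, atlas c -> dom c x -> eta c x X (eta c x Y v) = 0].

Definition associated_to S (L : S -> set (quat2 R)) (eta : end_form S) : Prop :=
  [/\ surface_HP1 L, retraction_form eta,
      exists c x X v, [/\ atlas c, dom c x & eta c x X v != 0],
      forall c x X v, atlas c -> dom c x -> L x (eta c x X v) &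
      forall c x X v, atlas c -> dom c x -> L x v -> eta c x X v = 0].

Definition darboux S (phi : S -> quat2 R) (x : S) : set (quat2 R) :=
  quat_line (phi x).

Definition gauge S (r : S -> quat2 R -> quat2 R) (nabla : connection S) :
    connection S :=
  fun s c x X => r x (nabla (fun y => pinv setT (r y) (s y)) c x X).

Section SimpleFactor.
Variables (S : riemann_surface R) (rho : cplx R) (E L : S -> set (quat2 R)).

Definition splitting : Prop :=
  forall x, direct_sum3 (E x) (times_j (E x)) (L x).

Definition proj_E x := proj_along (E x) (set_add (times_j (E x)) (L x)).
Definition proj_Ej x := proj_along (times_j (E x)) (set_add (E x) (L x)).
Definition proj_L x := proj_along (L x) (set_add (E x) (times_j (E x))).

Definition gamma_rho (lambda : cplx R) : cplx R :=
  (Num.conj rho * (rho - lambda)) / (rho * (Num.conj rho - lambda)).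
Definition sigma_rho (lambda : cplx R) : cplx R :=
  Num.conj rho / (Num.conj rho - lambda).

Definition simple_factor (lambda : cplx R) (x : S) (v : quat2 R) : quat2 R :=
  rmul (proj_E x v) (c2q (gamma_rho lambda)) + proj_Ej x v +
  rmul (proj_L x v) (c2q (sigma_rho lambda)).

(* the limit for lambda --> infinity; [lim] itself does not apply to a product *)
Definition simple_factor_infty (x : S) (v : quat2 R) : quat2 R :=
  xget (0 : quat2 R)
    [set w : quat2 R | simple_factor lambda x v @[lambda --> @cinfty R] --> w].

Definition eta_hat_op : connection S :=
  fun s c x X =>
    let w := dform (fun y => proj_L y (s y)) c x X in
    - (rmul (proj_E x w) (c2q rho^-1) + rmul (proj_Ej x w) (c2q (Num.conj rho)^-1)).

(* The operator above is of order zero on sections: this is the form through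
   which it acts. *)
Definition eta_hat : end_form S :=
  fun c x X v => eta_hat_op (cst v) c x X.

End SimpleFactor.
End Maps.

(* Main.v *)
(* Write the parallel section as [phi = e alpha + psi beta] and put [F = f \o cov].
   Being parallel means [d alpha = - dF beta] and [d beta = - dF^d alpha rho],
   and the splitting assumption says that [alpha] has no zeros. In quaternionic
   coordinates [s = phi p + psi q] the projections onto E, Ej and L select the
   complex part of [p], its [j]-part, and [q]. Hence
     [etahat s = - phi rho^-1 alpha^-1 dF q],
   and the gauge identity splits into one scalar identity for [p] and one for
   [q]. Closedness of [etahat] comes from [dF /\ dF^d = dF^d /\ dF = 0] and the
   symmetry of second derivatives. The affine coordinate [fh] of the Darboux
   transform satisfies [d fh = alpha beta^-1 dF^d alpha rho beta^-1], and its
   dual surface is [F^d + beta rho^-1 alpha^-1], with differential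
   [beta rho^-1 alpha^-1 dF beta alpha^-1], so that no form has to be
   integrated; both are conformal because left and right multiplications by
   nonzero quaternions are similarities of R^4. *)

Require Import Defs.
From HB Require Import structures.
From mathcomp Require Import all_boot all_order all_algebra.
From mathcomp Require Import complex.
From mathcomp Require Import all_classical all_reals all_analysis.
From mathcomp Require Import ring lra.
Import numFieldNormedType.Exports.

Set Implicit Arguments.
Unset Strict Implicit.
Unset Printing Implicit Defensive.

Import Order.TTheory GRing.Theory Num.Theory.
Local Open Scope classical_set_scope.
Local Open Scope ring_scope.


(** Complex scalars act from the right, while E and Ej are [phi] times C and [phi] times Cj, and z j
    = j conj z. So right multiplication by z on the complex part of p together with right
    multiplication by conj z on its j-part is left multiplication of p by z. This is why rho belongs
    to E and its conjugate to Ej, and why the two terms of etahat merge into one factor rho^-1. The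
    scalars gamma and sigma enter through a few rational identities. Both sigma^-1 = 1 - lambda /
    conj rho and sigma^-1 gamma = 1 - lambda / rho are affine in lambda, which makes the dressed
    family affine in lambda; gamma^-1 (lambda - rho) sigma = - rho and (lambda - conj rho) sigma = -
    conj rho are constant, so the poles brought in by the dressing cancel. Quaternions do not
    commute: identities in few variables are checked on the four real coordinates, the others by
    cancelling units. The gauge action inverts r_lambda, which is impossible at rho and conj rho;
    the identity is proved at the other lambda, and these two values are reached as limits. *)

Local Notation coord := Defs.coord.
Local Notation rot := Defs.rot.

(** * Quaternions *)

Section QuaternionAlgebra.
Variable R : realType.
Implicit Types (p q : quat R) (z w : cplx R).

Lemma quat_mulE p q : p * q = qmul p q.
Proof. by []. Qed.

Lemma qone_coord : (1 : quat R) = mkq 1 0 0 0.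
Proof. by []. Qed.

Definition qconj q : quat R :=
  let a n := (q : 'rV_4) ord0 n in mkq (a 0) (- a 1) (- a 2) (- a 3).

Definition qinv q : quat R := (dot q q)^-1 *: qconj q.

Lemma dot4E p q : let a n := (p : 'rV_4) ord0 n in
  let b n := (q : 'rV_4) ord0 n in
  dot p q = a 0 * b 0 + a 1 * b 1 + a 2 * b 2 + a 3 * b 3.
Proof.
rewrite /dot !big_ord_recr big_ord0 /= add0r.
by congr (_ * _ + _ * _ + _ * _ + _ * _); congr (fun_of_matrix _ _ _); apply/val_inj.
Qed.

Lemma dot_eq0 q : (dot q q == 0) = (q == 0).
Proof.
apply/eqP/eqP => [|->]; last by rewrite dot4E !mxE; ring.
rewrite dot4E => h; apply: quatP; rewrite ![in RHS]mxE; nra.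
Qed.

Lemma qmulV q : q != 0 -> q * qinv q = 1.
Proof.
rewrite -dot_eq0 => q0; rewrite quat_mulE qone_coord /qinv /qmul.
move: q0; rewrite dot4E => q0.
by apply: quatP; rewrite !mkqE !mxE /=; field.
Qed.

Lemma qmulVl q : q != 0 -> qinv q * q = 1.
Proof.
rewrite -dot_eq0 => q0; rewrite quat_mulE qone_coord /qinv /qmul.
move: q0; rewrite dot4E => q0.
by apply: quatP; rewrite !mkqE !mxE /=; field.
Qed.

Lemma qinv0 : qinv 0 = 0.
Proof. by rewrite /qinv (eqP (_ : dot _ _ == 0)) ?dot_eq0 // invr0 scale0r. Qed.

Lemma quat_unitP p q : q * p = 1 /\ p * q = 1 -> p != 0.
Proof.
by move=> [_ h]; apply: contra_eq_neq h => ->; rewrite mul0r eq_sym oner_neq0.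
Qed.

Lemma qinv_out p : ~~ (p != 0) -> qinv p = p.
Proof. by rewrite negbK => /eqP ->; rewrite qinv0. Qed.

End QuaternionAlgebra.

(** The units are the nonzero quaternions, and [qinv 0 = 0] meets the convention that inversion
    fixes non-units. The cancellation lemmas of unit rings then replace [field], which requires
    commutativity. *)
HB.instance Definition _ (R : realType) :=
  GRing.NzRing_hasMulInverse.Build (quat R)
    (@qmulVl R) (@qmulV R) (@quat_unitP R) (@qinv_out R).

Section QuaternionInverse.
Variable R : realType.
Implicit Types (p q : quat R) (z w : cplx R).

Lemma quat_unitE q : (q \is a GRing.unit) = (q != 0).
Proof. by []. Qed.

Lemma quat_invE q : q^-1 = qinv q.
Proof. by []. Qed.

Lemma quat_mulf_eq0 p q : (p * q == 0) = (p == 0) || (q == 0).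
Proof.
case: (eqVneq p 0) => [->|p0]; first by rewrite mul0r eqxx.
case: (eqVneq q 0) => [->|q0]; first by rewrite mulr0 eqxx.
by apply/negbTE; rewrite -quat_unitE unitrMl ?quat_unitE.
Qed.

(** Polarised form of the multiplicativity of the quaternionic norm. *)
Lemma dot_sandwich (a b p q : quat R) :
  dot (a * p * b) (a * q * b) = dot a a * dot b b * dot p q.
Proof. by rewrite !dot4E !quat_mulE /qmul !mkqE; ring. Qed.

Lemma dot_gt0 q : q != 0 -> 0 < dot q q.
Proof.
by rewrite -dot_eq0 lt_def => -> /=; rewrite dot4E; nra.
Qed.

Lemma quat_scalerAl (a : R) p q : a *: (p * q) = (a *: p) * q.
Proof.
by apply: quatP; rewrite [in LHS]mxE quat_mulE /qmul !mkqE !mxE; ring.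
Qed.

Lemma quat_scalerAr (a : R) p q : a *: (p * q) = p * (a *: q).
Proof.
by apply: quatP; rewrite [in LHS]mxE quat_mulE /qmul !mkqE !mxE; ring.
Qed.

Lemma c2qE (a b : R) : c2q (a +i* b)%C = mkq a b 0 0.
Proof. by []. Qed.

Lemma c2qM z w : c2q (z * w) = c2q z * c2q w.
Proof.
case: z w => [a b] [c d]; rewrite !c2qE quat_mulE /qmul !mkqE.
by apply: quatP; rewrite ?mkqE /=; ring.
Qed.

Lemma c2qD z w : c2q (z + w) = c2q z + c2q w.
Proof.
case: z w => [a b] [c d]; rewrite !c2qE.
by apply: quatP; rewrite ![in RHS]mxE ?mkqE /=; ring.
Qed.

Lemma c2qN z : c2q (- z) = - c2q z.
Proof.
case: z => [a b]; rewrite !c2qE.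
by apply: quatP; rewrite ![in RHS]mxE ?mkqE /=; ring.
Qed.

Lemma c2q1 : c2q 1 = 1 :> quat R.
Proof. by []. Qed.

Lemma c2q0 : c2q 0 = 0 :> quat R.
Proof. by apply: quatP; rewrite ?mkqE mxE. Qed.

Lemma c2q_eq0 z : (c2q z == 0) = (z == 0).
Proof.
apply/eqP/eqP => [|->]; last exact: c2q0.
case: z => [a b] /[dup] /(congr1 (fun q : 'rV_4 => q ord0 0)) + 
  /(congr1 (fun q : 'rV_4 => q ord0 1)).
by rewrite c2qE !mkqE !mxE => -> ->.
Qed.

(** The decomposition of H into C and Cj, the complex coefficient of j standing on its left, since i
    j = k. *)
Definition cpart q : quat R :=
  mkq ((q : 'rV_4) ord0 0) ((q : 'rV_4) ord0 1) 0 0.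
Definition jpart q : quat R :=
  mkq 0 0 ((q : 'rV_4) ord0 2) ((q : 'rV_4) ord0 3).

Lemma cpartD p q : cpart (p + q) = cpart p + cpart q.
Proof. by apply: quatP; rewrite ![in RHS]mxE ?mkqE ?mxE /=; ring. Qed.

Lemma jpartD p q : jpart (p + q) = jpart p + jpart q.
Proof. by apply: quatP; rewrite ![in RHS]mxE ?mkqE ?mxE /=; ring. Qed.

Lemma cjpart q : cpart q + jpart q = q.
Proof. by apply: quatP; rewrite ![in LHS]mxE /=; ring. Qed.

Lemma cpartE q : cpart q =
  c2q ((q : 'rV_4) ord0 0 +i* (q : 'rV_4) ord0 1)%C.
Proof. by []. Qed.

Lemma jpartE q : jpart q =
  c2q ((q : 'rV_4) ord0 2 +i* (q : 'rV_4) ord0 3)%C * qj R.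
Proof. by rewrite /jpart /qj quat_mulE /qmul; apply: quatP; rewrite !mkqE /=; ring. Qed.

Lemma cpart_c2q z : cpart (c2q z) = c2q z.
Proof. by case: z => a b; apply: quatP; rewrite !mkqE. Qed.
Lemma cpart_c2qj z : cpart (c2q z * qj R) = 0.
Proof. by case: z => a b; apply: quatP; rewrite !mkqE /= ?mxE; ring. Qed.
Lemma jpart_c2q z : jpart (c2q z) = 0.
Proof. by case: z => a b; apply: quatP; rewrite !mkqE /= ?mxE; ring. Qed.
Lemma jpart_c2qj z : jpart (c2q z * qj R) = c2q z * qj R.
Proof. by case: z => a b; apply: quatP; rewrite !mkqE /= ?mxE; ring. Qed.

Lemma conj_cplxE z : Num.conj z = (complex.Re z -i* complex.Im z)%C.
Proof. by case: z. Qed.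

Lemma cpart_comm z q : cpart q * c2q z = c2q z * cpart q.
Proof. by rewrite cpartE -!c2qM mulrC. Qed.

(** The rule z j = j conj z, the only source of complex conjugates in the computation. *)
Lemma jpart_comm z q : jpart q * c2q (Num.conj z) = c2q z * jpart q.
Proof.
rewrite conj_cplxE; case: z => [a b]; rewrite !c2qE.
by apply: quatP; rewrite !mkqE /=; ring.
Qed.
Lemma cpart_mulr z q : cpart (q * c2q z) = cpart q * c2q z.
Proof. by case: z => [a b]; rewrite c2qE; apply: quatP; rewrite !mkqE /=; ring. Qed.
Lemma jpart_mulr z q : jpart (q * c2q z) = jpart q * c2q z.
Proof. by case: z => [a b]; rewrite c2qE; apply: quatP; rewrite !mkqE /=; ring. Qed.

Lemma cpart_id p : cpart (cpart p) = cpart p.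
Proof. by rewrite [in LHS](cpartE p) cpart_c2q. Qed.
Lemma cpart_jpart p : cpart (jpart p) = 0.
Proof. by rewrite jpartE cpart_c2qj. Qed.
Lemma jpart_cpart p : jpart (cpart p) = 0.
Proof. by rewrite cpartE jpart_c2q. Qed.
Lemma jpart_id p : jpart (jpart p) = jpart p.
Proof. by rewrite [in LHS](jpartE p) jpart_c2qj -jpartE. Qed.

End QuaternionInverse.

(** * Smooth maps on the plane *)

(** The first-order expansion of [f] at [x] is also one of [g], because the values agree at [x] and
    for small increments; uniqueness of the differential concludes. *)
Lemma near_eq_differentiable (R : numFieldType) (V W : normedModType R)
    (f g : V -> W) (x : V) :
  {near x, f =1 g} -> differentiable f x -> differentiable g x.
Proof.
move=> fg df.
have key : g \o shift x = cst (g x) + 'd f x +o_ 0 id.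
  apply/eqaddoP => e e0; have /eqaddoP/(_ _ e0) := diff_locally df.
  apply: filter_app; near=> h.
  rewrite /= !fctE /= (nbhs_singleton fg).
  suff -> : f (h + x) = g (h + x) by [].
  near: h; move: fg; rewrite {1}(near_shift 0 x) /=.
  by apply: filterS => h; rewrite /= subr0.
have dfc := diff_continuous df.
by apply/diff_locallyP; rewrite (diff_unique dfc key).
Unshelve. all: by end_near. Qed.

Section ContinuouslyDifferentiable.
Variable R : realType.
Implicit Types (U W : set (plane R)) (V : normedModType R).

Lemma Ck_sub V k U W (g : plane R -> V) : W `<=` U -> Ck k U g -> Ck k W g.
Proof.
move=> WU; elim: k g => [|k ih] g /=; first by move=> h x /WU /h.
by move=> [h1 h2]; split=> [x /WU/h1//|v]; exact: ih.
Qed.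

(** [Ck] tests a map defined on the whole plane point by point, so nothing is lost at a point of [W]
    by restricting to [W]. *)
Lemma Ck_local V k U (g : plane R -> V) :
  (forall x, U x -> exists2 W, W x & Ck k W g) -> Ck k U g.
Proof.
elim: k g => [|k ih] g /= h; first by move=> x /h[W Wx]; apply.
split=> [x /h[W Wx [+ _]]|v]; first exact.
by apply: ih => x /h[W Wx [_ /(_ v)]]; exists W.
Qed.

Lemma Ck_continuous V k U (g : plane R -> V) x :
  Ck k U g -> U x -> {for x, continuous g}.
Proof.
by case: k => [|k] /= => [h /h //|[h _] /h /differentiable_continuous].
Qed.

Lemma CkS V k U (g : plane R -> V) : Ck k.+1 U g -> Ck k U g.
Proof.
elim: k g => [|k ih] g; first by move=> h x /= Ux; exact: Ck_continuous h Ux.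
by move=> [h1 h2]; split=> // v; apply: ih; exact: h2.
Qed.

(** On an open set, equality of maps is equality near each point and so passes to directional
    derivatives. The closure properties below compute a derivative on [U] and conclude by this
    congruence. *)
Lemma Ck_congr V k U (g h : plane R -> V) :
  open U -> (forall x, U x -> g x = h x) -> Ck k U g -> Ck k U h.
Proof.
move=> oU; have gh_near (g' h' : plane R -> V) x : U x -> (forall x, U x -> g' x = h' x) ->
    {near x, g' =1 h'}.
  by move=> Ux e; near do [apply: e]; exact: open_nbhs_nbhs.
elim: k g h => [|k ih] g h gh /= => [c x Ux|[d c]].
  have := c x Ux; rewrite /prop_for /continuous_at -gh// => cg.
  apply: cvg_trans cg; apply: (@near_eq_cvg _ _ (nbhs x)).
  exact: gh_near Ux gh.
split=> [x Ux|v]; first exact: near_eq_differentiable (gh_near _ _ _ Ux gh) (d x Ux).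
apply: (ih _ _ _ (c v)) => x Ux; apply: near_eq_derive; exact: (gh_near g h).
Unshelve. all: by end_near. Qed.

Lemma Ck_cst V k U (a : V) : Ck k U (cst a).
Proof.
elim: k a => [|k ih] a /=; first by move=> x _; exact: cst_continuous.
split=> [x _|v]; first exact: differentiable_cst.
rewrite (_ : (fun x => _) = cst 0) //; apply/funext => x; exact: derive_cst.
Qed.

Lemma Ck_D V k U (g h : plane R -> V) : open U ->
  Ck k U g -> Ck k U h -> Ck k U (fun x => g x + h x).
Proof.
move=> oU; elim: k g h => [|k ih] g h /=.
  by move=> cg ch x Ux; apply: continuousD; [exact: cg|exact: ch].
move=> [dg cg] [dh ch]; split=> [x Ux|v].
  by apply: differentiableD; [exact: dg|exact: dh].
apply: Ck_congr (ih _ _ (cg v) (ch v)) => // x Ux.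
by rewrite deriveD//; apply: diff_derivable; [exact: dg|exact: dh].
Qed.

(** Directional derivatives commute with continuous linear maps. Matrix entries, components of
    pairs, negation and the expansion of a matrix in its entries are all instances. *)
Lemma Ck_linear V (W' : normedModType R) k U (L : {linear V -> W'})
    (g : plane R -> V) : continuous L -> open U ->
  Ck k U g -> Ck k U (fun x => L (g x)).
Proof.
move=> cL oU; elim: k g => [|k ih] g /=.
  by move=> cg x Ux; apply: continuous_comp; [exact: cg|exact: cL].
move=> [dg cg]; split=> [x Ux|v].
  by apply: differentiable_comp; [exact: dg|exact: linear_differentiable].
apply: Ck_congr (ih _ (cg v)) => // x Ux.
have dL := @linear_differentiable _ _ _ L (g x) cL.
rewrite [in RHS]deriveE; last by apply: differentiable_comp => //; exact: dg.
by rewrite diff_comp ?diff_lin //= -?deriveE//; exact: dg.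
Qed.

Lemma Ck_sum V k U n (g : 'I_n -> plane R -> V) : open U ->
  (forall i, Ck k U (g i)) -> Ck k U (fun x => \sum_(i < n) g i x).
Proof.
move=> oU; elim: n g => [|n ih] g cg.
  by rewrite (_ : (fun x => _) = cst 0); [exact: Ck_cst|
    apply/funext => x; rewrite big_ord0].
rewrite (_ : (fun x => _) =
  (fun x => \sum_(i < n) g (widen_ord (leqnSn n) i) x + g ord_max x)); last first.
  by apply/funext => x; rewrite big_ord_recr.
by apply: Ck_D => //; apply: ih.
Qed.

Lemma Ck_M k U (g h : plane R -> R) : open U ->
  Ck k U g -> Ck k U h -> Ck k U (fun x => g x * h x).
Proof.
move=> oU; elim: k g h => [|k ih] g h.
  by move=> cg ch x Ux; apply: continuousM; [exact: cg|exact: ch].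
move=> Cg Ch; have [[dg cg] [dh ch]] := (Cg, Ch); split=> [x Ux|v].
  by apply: differentiableM; [exact: dg|exact: dh].
have : Ck k U (fun x => g x * 'D_v h x + h x * 'D_v g x).
  by apply: Ck_D => //; apply: ih; by [exact: CkS|exact: ch|exact: cg].
apply: Ck_congr => // x Ux.
by rewrite [in RHS]deriveM//; apply: diff_derivable; [exact: dg|exact: dh].
Qed.

Lemma Ck_N V k U (g : plane R -> V) : open U -> Ck k U g ->
  Ck k U (fun x => - g x).
Proof.
move=> oU cg; rewrite (_ : (fun x => _) = (fun x => (-1) *: g x)).
  by apply: (@Ck_linear _ _ k U ( *:%R (-1)) g) => //; exact: scaler_continuous.
by apply/funext => x; rewrite scaleN1r.
Qed.

Lemma Ck_B V k U (g h : plane R -> V) : open U -> Ck k U g -> Ck k U h ->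
  Ck k U (fun x => g x - h x).
Proof. by move=> oU cg ch; apply: Ck_D => //; exact: Ck_N. Qed.

Lemma Ck_V k U (g : plane R -> R) : open U -> (forall x, U x -> g x != 0) ->
  Ck k U g -> Ck k U (fun x => (g x)^-1).
Proof.
move=> oU g0; elim: k => [cg x Ux|k ih Cg].
  by apply: continuousV; [exact: g0|exact: cg].
have [dg cg] := Cg; have Ci := ih (CkS Cg); split=> [x Ux|v].
  by apply: differentiableV; [exact: dg|exact: g0].
have : Ck k U (fun x => - ((g x)^-1 * (g x)^-1) * 'D_v g x).
  apply: Ck_M => //; last exact: cg.
  by apply: Ck_N => //; apply: Ck_M.
apply: Ck_congr => // x Ux.
rewrite deriveV; [by rewrite -invfM -expr2 | exact: g0 |].
by apply: diff_derivable; exact: dg.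
Qed.

Lemma Ck_coord k U m n (g : plane R -> 'M[R]_(m.+1, n.+1)) i j : open U ->
  Ck k U g -> Ck k U (fun x => g x i j).
Proof.
move=> oU cg.
have lin : linear (fun N : 'M[R]_(m.+1, n.+1) => N i j : R).
  by move=> a A B; rewrite !mxE.
pose M := GRing.isLinear.Build _ _ _ _ _ lin.
pose L : {linear _ -> _} := HB.pack (fun N : 'M[R]_(m.+1, n.+1) => N i j : R) M.
by apply: (@Ck_linear _ _ k U L g) => //; exact: coord_continuous.
Qed.

Lemma Ck_mx k U m n (g : plane R -> 'M[R]_(m.+1, n.+1)) : open U ->
  (forall i j, Ck k U (fun x => g x i j)) -> Ck k U g.
Proof.
move=> oU cg.
rewrite (_ : g = fun x => \sum_i \sum_j g x i j *: delta_mx i j); last first.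
  by apply/funext => x; exact: matrix_sum_delta.
apply: Ck_sum => // i; apply: Ck_sum => // j.
have lin : linear (fun a : R => a *: (delta_mx i j : 'M[R]_(m.+1, n.+1))).
  by move=> a A B; rewrite scalerDl scalerA.
pose M := GRing.isLinear.Build _ _ _ _ _ lin.
pose L : {linear R -> 'M[R]_(m.+1, n.+1)} :=
  HB.pack (fun a : R => a *: (delta_mx i j : 'M[R]_(m.+1, n.+1))) M.
by apply: (@Ck_linear _ _ k U L _) => //; exact: scalel_continuous.
Qed.

Lemma derive_pair V (W' : normedModType R) (g : plane R -> V) (h : plane R -> W')
    x v : differentiable g x -> differentiable h x ->
  'D_v (fun x => (g x, h x)) x = ('D_v g x, 'D_v h x).
Proof.
by move=> dg dh; rewrite !deriveE ?diff_pair//; exact: differentiable_pair.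
Qed.

Lemma Ck_pair V (W' : normedModType R) k U (g : plane R -> V) (h : plane R -> W') :
  open U -> Ck k U g -> Ck k U h -> Ck k U (fun x => (g x, h x)).
Proof.
move=> oU; elim: k g h => [|k ih] g h.
  move=> cg ch x Ux; have cgx : g @ x --> g x := cg x Ux.
  have chx : h @ x --> h x := ch x Ux.
  exact: (cvg_pair cgx chx).
move=> [dg cg] [dh ch]; split=> [x Ux|v].
  by apply: differentiable_pair; [exact: dg|exact: dh].
apply: Ck_congr (ih _ _ (cg v) (ch v)) => // x Ux.
by rewrite derive_pair//; [exact: dg|exact: dh].
Qed.

Lemma Ck_fst V (W' : normedModType R) k U (g : plane R -> V * W') :
  open U -> Ck k U g -> Ck k U (fun x => (g x).1).
Proof.
move=> oU cg.
have lin : linear (fst : V * W' -> V) by move=> a A B.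
pose M := GRing.isLinear.Build _ _ _ _ _ lin.
pose L : {linear _ -> _} := HB.pack (fst : V * W' -> V) M.
by apply: (@Ck_linear _ _ k U L g) => // x; exact: cvg_fst.
Qed.

Lemma Ck_snd V (W' : normedModType R) k U (g : plane R -> V * W') :
  open U -> Ck k U g -> Ck k U (fun x => (g x).2).
Proof.
move=> oU cg.
have lin : linear (snd : V * W' -> W') by move=> a A B.
pose M := GRing.isLinear.Build _ _ _ _ _ lin.
pose L : {linear _ -> _} := HB.pack (snd : V * W' -> W') M.
by apply: (@Ck_linear _ _ k U L g) => // x; exact: cvg_snd.
Qed.

Lemma derive_comp V (g : plane R -> V) (h : plane R -> plane R) x v :
  differentiable h x -> differentiable g (h x) ->
  'D_v (g \o h) x = 'D_('D_v h x) g (h x).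
Proof.
move=> dh dg; rewrite deriveE; last exact: differentiable_comp.
by rewrite diff_comp//= (deriveE _ dg) (deriveE v dh).
Qed.

Lemma derive_sum_coord (g : plane R -> R) x (v : plane R) :
  differentiable g x ->
  'D_v g x = \sum_i v ord0 i * 'D_(delta_mx 0 i) g x.
Proof.
move=> dg; rewrite deriveE// {1}(row_sum_delta v) linear_sum.
by apply: eq_bigr => i _; rewrite linearZ deriveE.
Qed.

(** The chain rule differentiates [g] in the direction ['D_v h x], which varies with x, whereas [Ck]
    controls derivatives in fixed directions. Expanding the direction in the standard basis gives a
    sum of products to which induction applies. *)
Lemma Ck_comp k U W (g : plane R -> R) (h : plane R -> plane R) : open U ->
  (forall x, U x -> W (h x)) -> Ck k W g -> Ck k U h -> Ck k U (g \o h).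
Proof.
move=> oU UW; elim: k g => [|k ih] g.
  move=> cg ch x Ux; apply: continuous_comp; first exact: ch.
  exact/cg/UW.
move=> [dg cg] Ch; have [dh ch] := Ch; split=> [x Ux|v].
  by apply: differentiable_comp; [exact: dh|exact/dg/UW].
have : Ck k U (fun x => \sum_i ('D_v h x) ord0 i * ('D_(delta_mx 0 i) g \o h) x).
  apply: Ck_sum => // i; apply: Ck_M => //; first exact/Ck_coord/ch.
  by apply: ih; [exact: cg|exact: CkS].
apply: Ck_congr => // x Ux; rewrite (derive_comp v (dh x Ux) (dg _ (UW x Ux))).
by rewrite (derive_sum_coord _ (dg _ (UW x Ux))).
Qed.

End ContinuouslyDifferentiable.

(** * Symmetry of second derivatives *)

Section SecondDerivatives.
Variable R : realType.

Section Lines.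
Variables (V W : normedModType R).

Lemma is_derive_line (g : V -> W) (z X : V) (t : R) :
  derivable g (z + t *: X) X ->
  is_derive t 1 (fun t => g (z + t *: X)) ('D_X g (z + t *: X)).
Proof.
have E : (fun h => h^-1 *: (((fun t => g (z + t *: X)) \o shift t) (h *: 1) -
      g (z + t *: X))) =
    (fun h => h^-1 *: ((g \o shift (z + t *: X)) (h *: X) - g (z + t *: X))).
  apply/funext => h /=; rewrite (_ : h *: 1 = h); last by rewrite /GRing.scale /= mulr1.
  by rewrite scalerDl addrCA.
by move=> dg; apply: DeriveDef; rewrite /derivable /derive E.
Qed.

Lemma is_derive_translate (g : V -> W) (z c X : V) : derivable g (z + c) X ->
  is_derive z X (fun z => g (z + c)) ('D_X g (z + c)).
Proof.
have E : (fun h => h^-1 *: (((fun z => g (z + c)) \o shift z) (h *: X) -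
      g (z + c))) =
    (fun h => h^-1 *: ((g \o shift (z + c)) (h *: X) - g (z + c))).
  by apply/funext => h /=; rewrite addrA.
by move=> dg; apply: DeriveDef; rewrite /derivable /derive E.
Qed.

End Lines.

Lemma MVT_line (V : normedModType R) (g : V -> R) (z X : V) (s : R) : 0 < s ->
  (forall t, 0 <= t <= s -> derivable g (z + t *: X) X) ->
  exists2 t, 0 <= t <= s & g (z + s *: X) - g z = 'D_X g (z + t *: X) * s.
Proof.
move=> s0 dg.
have [||t] := @MVT R (fun t => g (z + t *: X)) (fun t => 'D_X g (z + t *: X)) 0 s s0.
- move=> t; rewrite in_itv /= => /andP[t0 ts]; apply: is_derive_line.
  by apply: dg; rewrite !ltW.
- apply: derivable_within_continuous => t; rewrite in_itv /= => ts.
  by have [] := is_derive_line (dg t ts).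
rewrite in_itv /= scale0r addr0 subr0 => /andP[t0 ts] e.
by exists t => //; rewrite !ltW.
Qed.

(* The mean value theorem along [X], then along [Y]. *)
Lemma second_difference (V : normedModType R) (g : V -> R) (x X Y : V) (s : R) :
  0 < s ->
  (forall t r, 0 <= t <= s -> 0 <= r <= s ->
     derivable g (x + t *: X + r *: Y) X /\
     derivable ('D_X g) (x + t *: X + r *: Y) Y) ->
  exists t r, [/\ 0 <= t <= s, 0 <= r <= s &
    g (x + s *: X + s *: Y) - g (x + s *: X) - (g (x + s *: Y) - g x) =
    'D_Y ('D_X g) (x + t *: X + r *: Y) * s * s].
Proof.
move=> s0 dg; have s0s : 0 <= s <= s by rewrite ltW /=.
have s00 : 0 <= (0 : R) <= s by apply/andP; split=> //; exact: ltW.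
have dgs t : 0 <= t <= s ->
    is_derive (x + t *: X) X (fun z => g (z + s *: Y)) ('D_X g (x + t *: X + s *: Y)).
  by move=> ts; exact: (is_derive_translate (dg t s ts s0s).1).
have dg0 t : 0 <= t <= s -> is_derive (x + t *: X) X g ('D_X g (x + t *: X)).
  move=> ts; apply: derivableP; have [h _] := dg t 0 ts s00.
  by rewrite scale0r addr0 in h.
have dG t : 0 <= t <= s -> is_derive (x + t *: X) X (fun z => g (z + s *: Y) - g z)
    ('D_X g (x + t *: X + s *: Y) - 'D_X g (x + t *: X)).
  by move=> ts; apply: is_deriveB; [exact: dgs|exact: dg0].
have [t ts ->] := @MVT_line _ (fun z => g (z + s *: Y) - g z) x X s s0
  (fun t ts => @ex_derive _ _ _ _ _ _ _ (dG t ts)).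
rewrite (@derive_val _ _ _ _ _ _ _ (dG t ts)).
have [r rs ->] := @MVT_line _ ('D_X g) (x + t *: X) Y s s0 (fun r rs =>
  (dg t r ts rs).2).
by exists t, r.
Qed.

(* Both mixed derivatives, at points close to [x], are the second difference
   quotient, which is symmetric in [X] and [Y]. *)
Lemma derive_sym_real (U : set (plane R)) (g : plane R -> R) (x X Y : plane R) :
  open U -> U x -> Ck 2 U g -> 'D_X ('D_Y g) x = 'D_Y ('D_X g) x.
Proof.
move=> oU Ux [dg cg].
have dDg Z z : U z -> differentiable ('D_Z g) z by case: (cg Z) => + _; apply.
have cDD Z Z' : {for x, continuous ('D_Z ('D_Z' g))}.
  by apply: (@Ck_continuous _ _ 0 U) => //; case: (cg Z') => _; apply.
apply: contrapT => /eqP ne.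
(* Half the gap between the two mixed derivatives at [x]: a single number cannot be closer than this
   to both of them. *)
pose e := `|'D_X ('D_Y g) x - 'D_Y ('D_X g) x| / 2.
have e0 : 0 < e by rewrite divr_gt0// normr_gt0 subr_eq0.
have /cvgrPdist_lt/(_ _ e0) nA := cDD X Y.
have /cvgrPdist_lt/(_ _ e0) nB := cDD Y X.
have nU : nbhs x U by exact: open_nbhs_nbhs.
have : nbhs x (U `&` ([set z | `|'D_X ('D_Y g) x - 'D_X ('D_Y g) z| < e] `&`
    [set z | `|'D_Y ('D_X g) x - 'D_Y ('D_X g) z| < e])).
  by apply: filterI; [exact: nU|apply: filterI; [exact: nA|exact: nB]].
move=> /nbhs_ballP[d /= d0 hd].
(* With this step the whole parallelogram on [s *: X] and [s *: Y] stays in the ball of radius [d];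
   the summand 1 covers the case in which [X] and [Y] both vanish. *)
pose s := d / 2 / (`|X| + `|Y| + 1).
have n0 : 0 < `|X| + `|Y| + 1 by rewrite ltr_wpDl// addr_ge0.
have s0 : 0 < s by rewrite !divr_gt0.
have bd t r Z Z' : `|Z| + `|Z'| = `|X| + `|Y| -> 0 <= t <= s -> 0 <= r <= s ->
    ball x d (x + t *: Z + r *: Z').
  move=> ZZ /andP[t0 ts] /andP[r0 rs]; rewrite -ball_normE /=.
  rewrite -addrA opprD addrA subrr add0r normrN.
  apply: le_lt_trans (ler_normD _ _) _; rewrite !normrZ !ger0_norm//.
  apply: (@le_lt_trans _ _ (s * (`|X| + `|Y|))).
    by rewrite -ZZ mulrDr lerD// ler_wpM2r.
  apply: (@le_lt_trans _ _ (s * (`|X| + `|Y| + 1))).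
    by rewrite ler_pM2l// lerDl.
  by rewrite /s divfK ?gt_eqF// ltr_pdivrMr// ltr_pMr// ltr1n.
have [t [r [ts rs e1]]] := @second_difference _ g x X Y s s0 (fun t r ts rs =>
  let h := (hd _ (bd t r X Y erefl ts rs)).1 in
    conj (diff_derivable (dg _ h)) (diff_derivable (dDg X _ h))).
have YX : `|Y| + `|X| = `|X| + `|Y| by rewrite addrC.
have [t' [r' [ts' rs' e2]]] := @second_difference _ g x Y X s s0 (fun t r ts rs =>
  let h := (hd _ (bd t r Y X YX ts rs)).1 in
    conj (diff_derivable (dg _ h)) (diff_derivable (dDg Y _ h))).
have E : 'D_Y ('D_X g) (x + t *: X + r *: Y) = 'D_X ('D_Y g) (x + t' *: Y + r' *: X).
  apply: (mulIf (lt0r_neq0 s0)); apply: (mulIf (lt0r_neq0 s0)).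
  have sw a b c d' : a - b - (c - d') = a - c - (b - d') :> R by ring.
  apply: etrans (esym e1) (etrans _ e2).
  have -> : x + s *: Y + s *: X = x + s *: X + s *: Y by exact: addrAC.
  exact: sw.
have [_ [_ /= hB]] := hd _ (bd t r X Y erefl ts rs).
have [_ [/= hA _]] := hd _ (bd t' r' Y X YX ts' rs').
rewrite E in hB.
have tri (a b c : R) : `|a - c| < `|a - b| / 2 -> `|b - c| < `|a - b| / 2 -> False.
  move=> h1 h2; have := ltrD h1 h2; rewrite -splitr (distrC b) => /lt_geF/negP; apply.
  by apply: le_trans (ler_normD _ _); rewrite subrKA.
exact: tri hA hB.
Qed.

Lemma derive_coord n (g : plane R -> 'rV[R]_n) x X i : derivable g x X ->
  ('D_X g x) ord0 i = 'D_X (fun z => g z ord0 i) x.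
Proof. by move=> dg; rewrite derive_mx// mxE. Qed.

Lemma derive_sym n (U : set (plane R)) (g : plane R -> 'rV[R]_n.+1)
    (x X Y : plane R) :
  open U -> U x -> Ck 2 U g -> 'D_X ('D_Y g) x = 'D_Y ('D_X g) x.
Proof.
move=> oU Ux Cg; have [dg cg] := Cg.
have dDg Z : differentiable ('D_Z g) x by case: (cg Z) => + _; apply.
have DD Z Z' i : ('D_Z ('D_Z' g) x) ord0 i = 'D_Z ('D_Z' (fun z => g z ord0 i)) x.
  rewrite derive_coord; last exact: diff_derivable.
  apply: near_eq_derive; have : nbhs x U by exact: open_nbhs_nbhs.
  by apply: filterS => z Uz; rewrite derive_coord//; apply/diff_derivable/dg.
apply/rowP => i; apply: (etrans (DD X Y i)); apply: (etrans _ (esym (DD Y X i))).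
apply: (derive_sym_real _ _ oU Ux); exact: (@Ck_coord R 2 U 0 n g).
Qed.

End SecondDerivatives.

(** * Calculus of quaternion-valued maps *)

Section QuaternionCalculus.
Variable R : realType.
Implicit Types (U : set (plane R)) (g h : plane R -> quat R).

Lemma Ck_quat k U g : open U ->
  Ck k U (fun x => (g x : 'rV_4) ord0 0) -> Ck k U (fun x => (g x : 'rV_4) ord0 1) ->
  Ck k U (fun x => (g x : 'rV_4) ord0 2) -> Ck k U (fun x => (g x : 'rV_4) ord0 3) ->
  Ck k U g.
Proof.
move=> oU h0 h1 h2 h3; apply: (@Ck_mx R k U 0 3 g) => // i j; rewrite (ord1 i).
by case: j => [[|[|[|[|n]]]]] //= hn;
  [move: h0|move: h1|move: h2|move: h3]; congr (Ck k U _); apply/funext => x;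
  congr (fun_of_matrix _ _ _); apply/val_inj.
Qed.

Lemma Ck_quat_coord k U g i : open U -> Ck k U g ->
  Ck k U (fun x => (g x : 'rV_4) ord0 i).
Proof. by move=> oU cg; exact: (@Ck_coord R k U 0 3 g). Qed.

Lemma Ck_qM k U g h : open U -> Ck k U g -> Ck k U h -> Ck k U (fun x => g x * h x).
Proof.
move=> oU cg ch; have Cg i := @Ck_quat_coord k U g i oU cg.
have Ch i := @Ck_quat_coord k U h i oU ch.
apply: Ck_quat => //;
  under [X in Ck _ _ X]funext => x do rewrite quat_mulE /qmul mkqE;
  by do ?[exact: Cg|exact: Ch|apply: Ck_B => //|apply: Ck_M => //|apply: Ck_D => //].
Qed.

Lemma Ck_qV k U g : open U -> (forall x, U x -> g x != 0) -> Ck k U g ->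
  Ck k U (fun x => (g x)^-1).
Proof.
move=> oU g0 cg; have Cg i := @Ck_quat_coord k U g i oU cg.
have Cd : Ck k U (fun x => (dot (g x) (g x))^-1).
  apply: Ck_V => //; first by move=> x Ux; rewrite dot_eq0 g0.
  under [X in Ck _ _ X]funext => x do rewrite dot4E /=.
  by do ?[exact: Cg|apply: Ck_M => //|apply: Ck_D => //].
apply: Ck_quat => //;
  under [X in Ck _ _ X]funext => x do rewrite quat_invE /qinv mxE mkqE;
  by apply: Ck_M => //; try apply: Ck_N => //; exact: Cg.
Qed.

Lemma is_derive_quat g x X (dg : quat R) :
  is_derive x X (fun z => (g z : 'rV_4) ord0 0) ((dg : 'rV_4) ord0 0) ->
  is_derive x X (fun z => (g z : 'rV_4) ord0 1) ((dg : 'rV_4) ord0 1) ->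
  is_derive x X (fun z => (g z : 'rV_4) ord0 2) ((dg : 'rV_4) ord0 2) ->
  is_derive x X (fun z => (g z : 'rV_4) ord0 3) ((dg : 'rV_4) ord0 3) ->
  is_derive x X g dg.
Proof.
move=> h0 h1 h2 h3.
have H i : is_derive x X (fun z => (g z : 'rV_4) ord0 i) ((dg : 'rV_4) ord0 i).
  case: i => [[|[|[|[|n]]]]] //= hn;
  [move: h0|move: h1|move: h2|move: h3]; congr (is_derive x X _ _);
  by try apply/funext => z; congr (fun_of_matrix _ _ _); apply/val_inj.
have dv : derivable (g : plane R -> 'rV_4) x X.
  by apply/derivable_mxP => i j; rewrite (ord1 i); case: (H j).
apply: DeriveDef; first exact: dv.
apply/rowP => i; rewrite (@derive_coord R 4 g)//; exact: derive_val.
Qed.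

Lemma is_derive_quat_coord g x X (dg : quat R) i : is_derive x X g dg ->
  is_derive x X (fun z => (g z : 'rV_4) ord0 i) ((dg : 'rV_4) ord0 i).
Proof.
move=> [dv <-]; have dv' : derivable (g : plane R -> 'rV_4) x X by exact: dv.
apply: DeriveDef; last by rewrite -(@derive_coord R 4 g).
by move/derivable_mxP : dv'; apply.
Qed.

Lemma is_derive_qM g h x X (dg dh : quat R) :
  is_derive x X g dg -> is_derive x X h dh ->
  is_derive x X (fun z => g z * h z) (dg * h x + g x * dh).
Proof.
move=> Hg Hh; have cg i := @is_derive_quat_coord g x X dg i Hg.
have ch i := @is_derive_quat_coord h x X dh i Hh.
have [g0 g1 g2 g3] := And4 (cg 0) (cg 1) (cg 2) (cg 3).
have [h0 h1 h2 h3] := And4 (ch 0) (ch 1) (ch 2) (ch 3).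
by apply: is_derive_quat; rewrite mxE !quat_mulE /qmul !mkqE;
  (under [X in is_derive _ _ X]funext => z do rewrite quat_mulE /qmul mkqE);
  apply: is_derive_eq; rewrite /GRing.scale /=; ring.
Qed.

Lemma is_derive_qV g x X (dg : quat R) : g x != 0 -> {for x, continuous g} ->
  is_derive x X g dg ->
  is_derive x X (fun z => (g z)^-1) (- ((g x)^-1 * dg * (g x)^-1)).
Proof.
move=> g0 cgx Hg; have cg i := @is_derive_quat_coord g x X dg i Hg.
have [c0 c1 c2 c3] := And4 (cg 0) (cg 1) (cg 2) (cg 3).
have dd : derivable (fun z => (dot (g z) (g z))^-1) x X.
  apply: derivableV; first by rewrite dot_eq0.
  under [X in derivable X]funext => z do rewrite dot4E /=.
  by apply: ex_derive.
have dg' i : derivable (fun z => (g z : 'rV_4) ord0 i) x X.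
  by case: (cg i).
have dv : derivable (fun z => (g z)^-1) x X.
  apply: ex_derive; apply: (@is_derive_quat _ _ _ (\row_i
    'D_X (fun z => ((g z)^-1 : 'rV_4) ord0 i) x));
  rewrite mxE; apply: derivableP;
  (under [X in derivable X]funext => z do rewrite quat_invE /qinv mxE mkqE);
  apply: (derivableM dd).
  - exact: (dg' 0).
  - exact: (derivableN (dg' 1)).
  - exact: (derivableN (dg' 2)).
  - exact: (derivableN (dg' 3)).
(* Now differentiate [g * g^-1 = 1]. *)
suff <- : 'D_X (fun z => (g z)^-1) x = - ((g x)^-1 * dg * (g x)^-1).
  exact: derivableP.
have Hp := is_derive_qM Hg (derivableP dv).
(* Derivability along [X] says nothing about the other directions; it is continuity that keeps [g]
   away from zero in a full neighbourhood. *)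
have near1 : \forall z \near x, g z * (g z)^-1 = cst (1 : quat R) z.
  have : \forall z \near x, g z != 0 by exact: (@cvgr_neq0 _ _ _ _ _ g (g x) cgx g0).
  by apply: filterS => z /= gz; rewrite divrr.
have := @derive_val _ _ _ _ _ _ _ Hp.
rewrite (near_eq_derive X near1).
rewrite derive_cst => /esym/eqP; rewrite addrC addr_eq0 => /eqP e.
apply: (@mulrI _ (g x)); first by rewrite quat_unitE.
by rewrite e mulrN !mulrA divrr// mul1r.
Qed.

Lemma is_derive_pair g h x X dg dh : is_derive x X g dg -> is_derive x X h dh ->
  is_derive x X (fun z => (g z, h z)) (dg, dh).
Proof.
move=> [dvg eg] [dvh eh]; have cp := cvg_pair dvg dvh.
have cp' : (fun t : R => t^-1 *: (((fun z => (g z, h z)) \o shift x) (t *: X)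
    - (g x, h x))) @ 0^' --> (dg, dh).
  by rewrite -eg -eh; exact: cp.
apply: DeriveDef; first by apply/cvg_ex; exists (dg, dh).
exact/cvg_lim.
Qed.

Lemma is_derive_fst (p : plane R -> quat2 R) x X dp : is_derive x X p dp ->
  is_derive x X (fun z => (p z).1) dp.1.
Proof.
move=> [/cvg_ex[l cl] e].
have <- : l = dp by rewrite -e; apply/esym/cvg_lim.
pose q t := t^-1 *: ((p \o shift x) (t *: X) - p x).
have c1 : (fst \o q) @ 0^' --> l.1.
  exact: (cvg_comp q fst cl (@cvg_fst _ _ (nbhs l.1) (nbhs l.2) _)).
by apply: DeriveDef; [apply/cvg_ex; exists l.1; exact: c1|apply: cvg_lim => //; exact: c1].
Qed.

Lemma is_derive_snd (p : plane R -> quat2 R) x X dp : is_derive x X p dp ->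
  is_derive x X (fun z => (p z).2) dp.2.
Proof.
move=> [/cvg_ex[l cl] e].
have <- : l = dp by rewrite -e; apply/esym/cvg_lim.
pose q t := t^-1 *: ((p \o shift x) (t *: X) - p x).
have c1 : (snd \o q) @ 0^' --> l.2.
  exact: (cvg_comp q snd cl (@cvg_snd _ _ (nbhs l.1) (nbhs l.2) _)).
by apply: DeriveDef; [apply/cvg_ex; exists l.2; exact: c1|apply: cvg_lim => //; exact: c1].
Qed.

End QuaternionCalculus.

(** * Charts *)

Section Charts.
Variables (R : realType) (S : riemann_surface R).
Implicit Types (c : chart R S) (U A : set S) (x : S).

Lemma param_dom c u : atlas c -> chart_image c u ->
  dom c (param c u) /\ coord c (param c u) = u.
Proof. by move=> ac [x dx <-]; rewrite (coordK (atlas_chart ac)). Qed.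

Lemma coord_image c x : dom c x -> chart_image c (coord c x).
Proof. by exists x. Qed.

Lemma open_image c : atlas c -> open (chart_image c).
Proof. by move=> ac; exact: chart_image_open (atlas_chart ac). Qed.

Lemma param_continuous_at c u : atlas c -> chart_image c u ->
  {for u, continuous (param c)}.
Proof.
move=> ac iu; have := param_continuous (atlas_chart ac).
by rewrite continuous_open_subspace; [apply; rewrite inE|exact: open_image].
Qed.

Lemma coord_continuous_at c x : atlas c -> dom c x -> {for x, continuous (coord c)}.
Proof.
move=> ac iu; have := Defs.coord_continuous (atlas_chart ac).
rewrite continuous_open_subspace; first by apply; rewrite inE.
exact: (Defs.dom_open (atlas_chart ac)).
Qed.

Lemma chart_subimageE c A : atlas c ->
  coord c @` (dom c `&` A) = chart_image c `&` param c @^-1` A.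
Proof.
move=> ac; apply/seteqP; split=> [_ [x [dx Ax] <-]|u [iu Au]].
  by split; [exists x|rewrite /= (coordK (atlas_chart ac))].
by have [d e] := param_dom ac iu; exists (param c u).
Qed.

Lemma open_subimage c A : atlas c -> open A -> open (coord c @` (dom c `&` A)).
Proof.
move=> ac oA; rewrite chart_subimageE// openE => u [iu Au].
apply: filterI; first exact: open_nbhs_nbhs (conj (open_image ac) iu).
by apply: (param_continuous_at ac iu); exact: open_nbhs_nbhs.
Qed.

Lemma nbhs_subimage c x A : atlas c -> dom c x -> open A -> A x ->
  nbhs (coord c x) (coord c @` (dom c `&` A)).
Proof.
move=> ac dx oA Ax; apply: open_nbhs_nbhs; split; first exact: open_subimage.
by exists x.
Qed.

Lemma smooth_chart (V : normedModType R) (s : S -> V) c :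
  smooth_on setT s -> atlas c -> smooth_plane (chart_image c) (s \o param c).
Proof. by move=> sm ac; have := sm c ac; rewrite setIT. Qed.

Lemma smooth_differentiable (V : normedModType R) (s : S -> V) c x :
  smooth_on setT s -> atlas c -> dom c x -> differentiable (s \o param c) (coord c x).
Proof.
by move=> sm ac dx; have [+ _] := smooth_chart sm ac 1; apply; exact: coord_image.
Qed.

Lemma smooth_on_local (V : normedModType R) (s : S -> V) :
  (forall x, exists2 U, U x & smooth_on U s) -> smooth_on setT s.
Proof.
move=> loc c ac k; apply: Ck_local => _ [x [dx _] <-].
have [U Ux sU] := loc x; exists (coord c @` (dom c `&` U)); first by exists x.
exact: sU.
Qed.

(** A small nonzero displacement in a chart leads to a second point: surfaces have no isolated
    points. A property required only on punctured neighbourhoods, such as being immersed, therefore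
    holds somewhere. *)
Lemma not_isolated x (P : S -> Prop) :
  (\forall y \near x^', P y) -> exists2 y, y != x & P y.
Proof.
move=> nP; have [c ac dx] := atlas_cover x.
have [/= iu ex] : chart_image c (coord c x) /\ param c (coord c x) = x.
  by split; [exact: coord_image|exact: (coordK (atlas_chart ac) dx)].
have nN : nbhs (coord c x) (chart_image c `&` param c @^-1` [set y | y != x -> P y]).
  apply: filterI; first exact: open_nbhs_nbhs (conj (open_image ac) iu).
  by apply: (param_continuous_at ac iu); rewrite ex; exact: nP.
move/nbhs_ballP : nN => [e /= e0 he].
(* The norm is the maximum norm, in which the all-ones vector has length 1. *)
pose v : plane R := (e / 2) *: const_mx 1.
have v0 : v != 0.
  apply/eqP => /rowP /(_ ord0); rewrite !mxE mulr1 => /eqP.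
  by rewrite gt_eqF// divr_gt0.
have [] := he (coord c x + v).
  rewrite -ball_normE /= opprD addrA subrr add0r normrN normrZ ger0_norm; last first.
    by rewrite ltW// divr_gt0.
  rewrite (_ : `|const_mx 1| = 1) ?mulr1 ?ltr_pdivrMr ?ltr_pMr ?ltr1n//.
  apply/eqP; rewrite eq_le; apply/andP; split.
    rewrite [leLHS]/Num.Def.normr/= mx_normrE; apply: bigmax_le => // i _.
    by rewrite mxE normr1.
  rewrite [leRHS]/Num.Def.normr/= mx_normrE.
  apply: le_trans (le_bigmax _ _ (ord0, ord0)); by rewrite mxE normr1.
move=> iv Pv; have [d e'] := param_dom ac iv.
have ne : param c (coord c x + v) != x.
  apply: contra_neq v0 => /(congr1 (coord c)); rewrite e' => /eqP.
  by rewrite -subr_eq0 addrC addKr => /eqP.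
by exists (param c (coord c x + v)) => //; exact: Pv.
Qed.

End Charts.

(** * Composition with holomorphic maps between surfaces *)

Section ChainRule.
Variable R : realType.
Implicit Types S T : riemann_surface R.

Lemma Ck_comp_quat k (U W : set (plane R)) (g : plane R -> quat R)
    (h : plane R -> plane R) : open U ->
  (forall x, U x -> W (h x)) -> open W -> Ck k W g -> Ck k U h -> Ck k U (g \o h).
Proof.
move=> oU UW oW cg ch; have Cg i := @Ck_quat_coord R k W g i oW cg.
by apply: Ck_quat => //; exact: (@Ck_comp R k U W _ h oU UW (Cg _) ch).
Qed.

Lemma open_preimage_in S T (U : set S) (V : set T) (h : S -> T) : open U -> open V ->
  (forall x, U x -> {for x, continuous h}) -> open (U `&` h @^-1` V).
Proof.
move=> oU oV ch; rewrite openE => x [Ux Vx]; apply: filterI.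
  exact: open_nbhs_nbhs.
by apply: (ch x Ux); exact: open_nbhs_nbhs.
Qed.

Section Composition.
Variables (S T : riemann_surface R) (h : S -> T) (U : set S).
Hypotheses (oU : open U) (holo : holomorphic_on U h).

Lemma chart_comp (V : normedModType R) (s : T -> V) (c : chart R S) (c' : chart R T) x :
  atlas c -> atlas c' -> dom c x -> dom c' (h x) -> U x ->
  \forall u \near coord c x,
    ((s \o param c') \o (coord c' \o h \o param c)) u = (s \o h \o param c) u.
Proof.
move=> ac ac' dx dx' Ux; have oW : open (U `&` h @^-1` dom c').
  by apply: open_preimage_in oU (Defs.dom_open (atlas_chart ac')) (proj1 holo).
have := nbhs_subimage ac dx oW (conj Ux dx').
apply: filterS => _ [y [dy [Uy dy']] <-] /=.
by rewrite (coordK (atlas_chart ac)) ?(coordK (atlas_chart ac')).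
Qed.

Lemma differentiable_coord_comp (c : chart R S) (c' : chart R T) x :
  atlas c -> atlas c' -> dom c x -> dom c' (h x) -> U x ->
  differentiable (coord c' \o h \o param c) (coord c x).
Proof.
move=> ac ac' dx dx' Ux; have [/(_ 1)[+ _] _] := (proj2 holo) c c' ac ac'.
by apply; exists x.
Qed.

Lemma rot_coord_comp (c : chart R S) (c' : chart R T) x X :
  atlas c -> atlas c' -> dom c x -> dom c' (h x) -> U x ->
  'D_(rot X) (coord c' \o h \o param c) (coord c x) =
  rot ('D_X (coord c' \o h \o param c) (coord c x)).
Proof.
move=> ac ac' dx dx' Ux; have [_ +] := (proj2 holo) c c' ac ac'.
by apply; exists x.
Qed.

Lemma dform_comp (V : normedModType R) (s : T -> V) (c : chart R S) (c' : chart R T) x X :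
  smooth_on setT s ->
  atlas c -> atlas c' -> dom c x -> dom c' (h x) -> U x ->
  dform (s \o h) c x X =
  dform s c' (h x) ('D_X (coord c' \o h \o param c) (coord c x)).
Proof.
move=> sm ac ac' dx dx' Ux; rewrite /dform.
have ex : param c (coord c x) = x by exact: (coordK (atlas_chart ac) dx).
rewrite -(near_eq_derive X (chart_comp s ac ac' dx dx' Ux)).
have d1 := differentiable_coord_comp ac ac' dx dx' Ux.
have d2 : differentiable (s \o param c') ((coord c' \o h \o param c) (coord c x)).
  by rewrite /= ex; exact: smooth_differentiable.
by rewrite (derive_comp X d1 d2) /= ex.
Qed.

Lemma smooth_on_comp (s : T -> quat R) : smooth_on setT s -> smooth_on U (s \o h).
Proof.
move=> sm c ac k; apply: Ck_local => _ [x [dx Ux] <-].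
have [c' ac' dx'] := atlas_cover (h x).
have oU' : open (U `&` h @^-1` dom c').
  by apply: open_preimage_in oU (Defs.dom_open (atlas_chart ac')) (proj1 holo).
have oW := open_subimage ac oU'.
exists (coord c @` (dom c `&` (U `&` h @^-1` dom c'))); first by exists x.
have : Ck k (coord c @` (dom c `&` (U `&` h @^-1` dom c')))
    ((s \o param c') \o (coord c' \o h \o param c)).
  apply: (@Ck_comp_quat k _ (chart_image c')) => //.
  - move=> _ [y [dy [Uy dy']] <-] /=; apply: coord_image.
    by rewrite (coordK (atlas_chart ac)).
  - exact: open_image.
  - exact: smooth_chart.
  - by have [/(_ k)] := (proj2 holo) c c' ac ac'; rewrite setIA.
apply: Ck_congr => // _ [y [dy [Uy dy']] <-] /=.
by rewrite (coordK (atlas_chart ac)) ?(coordK (atlas_chart ac')).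
Qed.

End Composition.

(** This is the compatibility of the atlas; it makes the transition rule of [dform] the chain rule
    for the identity. *)
Lemma holomorphic_id S : holomorphic_on setT (@id S).
Proof.
split=> [x _|c c' ac ac']; first by move=> A.
by rewrite setIT preimage_id; exact: atlas_holomorphic.
Qed.

Lemma dform_transition S (V : normedModType R) (s : S -> V) c c' x X :
  smooth_on setT s -> atlas c -> atlas c' -> dom c x -> dom c' x ->
  dform s c' x ('D_X (coord c' \o param c) (coord c x)) = dform s c x X.
Proof.
move=> sm ac ac' dx dx'; symmetry.
exact: (@dform_comp S S id setT openT (holomorphic_id S) V s c c' x X).
Qed.

Lemma dform_linear S (V : normedModType R) (s : S -> V) c x X Y (a : R) :
  smooth_on setT s -> atlas c -> dom c x ->
  dform s c x (a *: X + Y) = a *: dform s c x X + dform s c x Y.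
Proof.
move=> sm ac dx; rewrite /dform !deriveE ?linearP//; exact: smooth_differentiable.
Qed.

End ChainRule.

(** * Conformality and coverings *)

Section Conformal.
Variable R : realType.
Implicit Types (S T : riemann_surface R) (X Y : plane R).

Lemma dot2E X Y : dot X Y = X ord0 0 * Y ord0 0 + X ord0 1 * Y ord0 1.
Proof.
rewrite /dot !big_ord_recr big_ord0 /= add0r.
by congr (_ * _ + _ * _); congr (fun_of_matrix _ _ _); apply/val_inj.
Qed.

Lemma dot_plane_gt0 X : X != 0 -> 0 < dot X X.
Proof.
move=> X0; rewrite dot2E lt_def; apply/andP; split; last by nra.
apply: contra_neq X0 => h; apply/rowP => i; rewrite mxE.
case: i => [[|[|n]]] //= hn.
  by rewrite (_ : Ordinal hn = 0); [nra|exact/val_inj].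
by rewrite (_ : Ordinal hn = 1); [nra|exact/val_inj].
Qed.

Lemma rotE X : (rot X ord0 0 = - X ord0 1) * (rot X ord0 1 = X ord0 0).
Proof. by rewrite !mxE. Qed.

Lemma plane_decomp X : let e := delta_mx 0 0 : plane R in
  X = X ord0 0 *: e + X ord0 1 *: rot e.
Proof.
move=> e; apply/rowP => i; rewrite !mxE.
case: i => [[|[|n]]] //= hn.
  by rewrite (_ : Ordinal hn = 0); [rewrite /=; ring|exact/val_inj].
by rewrite (_ : Ordinal hn = 1); [rewrite /=; ring|exact/val_inj].
Qed.

(* [B] is multiplication by a complex number. *)
Lemma complex_linear_conformal (B : plane R -> plane R) :
  linear B -> (forall X, B (rot X) = rot (B X)) -> (forall X, X != 0 -> B X != 0) ->
  exists2 m : R, 0 < m & forall X Y, dot (B X) (B Y) = m * dot X Y.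
Proof.
move=> linB rotB injB; pose e : plane R := delta_mx 0 0.
exists (dot (B e) (B e)).
  apply/dot_plane_gt0/injB/eqP => /rowP /(_ 0); rewrite !mxE /= => /eqP.
  by rewrite oner_eq0.
have BE X : B X = X ord0 0 *: B e + X ord0 1 *: rot (B e).
  rewrite {1}(plane_decomp X) -/e linB -rotB.
  have B0 : B 0 = 0 by have := linB (-1) 0 0; rewrite scaler0 addr0 scaleN1r addNr.
  by have := linB (X ord0 1) (rot e) 0; rewrite B0 !addr0 => ->.
by move=> X Y; rewrite !dot2E (BE X) (BE Y) !(rotE, mxE); ring.
Qed.

End Conformal.

Section Covering.
Variables (R : realType) (S T : riemann_surface R) (cov : S -> T).

(** [U] is the sheet through [x] over an evenly covered [V], and [k] the inverse of the covering on
    that sheet. *)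
Lemma covering_local : holomorphic_covering cov -> forall x : S,
  exists (U : set S) (V : set T) (k : T -> S),
  [/\ open U, open V, U x, holomorphic_on U cov & holomorphic_on V k] /\
  forall z, U z -> V (cov z) /\ k (cov z) = z.
Proof.
move=> [_ hc] x; have [V [I [U [oV Vx oU _ [pre hU]]]]] := hc (cov x).
have [n _ Unx] : (\bigcup_n U n) x by rewrite -pre.
have [bij holo [k [hk kK]]] := hU n.
exists (U n), V, k; split=> // z Unz; split; last exact: kK.
by case: bij => + _ _; apply.
Qed.

Hypothesis hcov : holomorphic_covering cov.

Lemma smooth_on_cover (s : T -> quat R) : smooth_on setT s -> smooth_on setT (s \o cov).
Proof.
move=> sm; apply: smooth_on_local => x.
have [U [V [k [[oU _ Ux hU _] _]]]] := covering_local hcov x.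
by exists U => //; exact: smooth_on_comp.
Qed.

(** In charts the differential [B] of the covering commutes with [rot], and the holomorphic local
    inverse makes it injective. It is thus a similarity of the plane, and the conformal factors
    multiply. *)
Lemma conformal_immersion_cover (s : T -> quat R) x : smooth_on setT s ->
  conformal_immersion_at s (cov x) -> conformal_immersion_at (s \o cov) x.
Proof.
move=> sm conf c ac dx.
have [U [V [k [[oU oV Ux hU hV] kK]]]] := covering_local hcov x.
have [Vx kx] := kK x Ux.
have [c' ac' dx'] := atlas_cover (cov x).
have [r r0 hr] := conf c' ac' dx'.
pose B X := 'D_X (coord c' \o cov \o param c) (coord c x).
have ex : param c (coord c x) = x by exact: (coordK (atlas_chart ac) dx).
have ex' : param c' (coord c' (cov x)) = cov x by exact: (coordK (atlas_chart ac') dx').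
have dB : differentiable (coord c' \o cov \o param c) (coord c x).
  by exact: (differentiable_coord_comp hU ac ac' dx dx' Ux).
have dxk : dom c (k (cov x)) by rewrite kx.
have dk : differentiable (coord c \o k \o param c') (coord c' (cov x)).
  by exact: (differentiable_coord_comp hV ac' ac dx' dxk Vx).
have dk' : differentiable (coord c \o k \o param c')
    ((coord c' \o cov \o param c) (coord c x)) by rewrite /= ex.
(* Differentiating [k \o cov = id] near [x] gives a left inverse of [B]. *)
have BK X : 'D_(B X) (coord c \o k \o param c') (coord c' (cov x)) = X.
  have e := derive_comp X dB dk'; rewrite /= ex -/(B X) in e.
  apply: (etrans (esym e)); apply: (etrans _ (derive_id (coord c x) X)).
  apply: near_eq_derive.
  have oW : open (U `&` cov @^-1` dom c').
    by apply: (open_preimage_in oU (Defs.dom_open (atlas_chart ac')) (proj1 hU)).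
  have := nbhs_subimage ac dx oW (conj Ux dx').
  apply: filterS => _ [y [dy [Uy dy']] <-] /=.
  rewrite (coordK (atlas_chart ac) dy) (coordK (atlas_chart ac') dy').
  by rewrite (kK y Uy).2.
have [] := @complex_linear_conformal R B.
- by move=> a X Y; rewrite /B !deriveE// linearP.
- by move=> X; exact: (rot_coord_comp hU X ac ac' dx dx' Ux).
- move=> X; apply: contra_neq => BX0.
  by rewrite -(BK X) BX0 derive0.
move=> m m0 hm; exists (r * m); first exact: mulr_gt0.
move=> X Y; rewrite !(dform_comp oU hU _ sm ac ac' dx dx' Ux).
by rewrite hr -/(B X) -/(B Y) hm mulrA.
Qed.

(** The covering is injective on a sheet, so points near [x] other than [x] do not land on [cov x]:
    punctured neighbourhoods pull back to punctured neighbourhoods. *)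
Lemma branched_conformal_cover (s : T -> quat R) :
  branched_conformal s -> branched_conformal (s \o cov).
Proof.
move=> [sm conf]; split; first exact: smooth_on_cover.
move=> x _; have [U [V [k [[oU oV Ux hU hV] kK]]]] := covering_local hcov x.
have := conf (cov x) I => /(hU.1 x Ux).
rewrite /dnbhs /within /= => near1.
have nU : nbhs x U by exact: open_nbhs_nbhs.
apply: filterS (filterI nU near1) => z [Uz hz] zx _.
apply: conformal_immersion_cover => //.
apply: (hz _ I).
by apply: contra_neq zx => ezx; rewrite -(kK z Uz).2 ezx (kK x Ux).2.
Qed.

End Covering.

(** * The splitting of the quaternionic plane *)

Section Splitting.
Variable R : realType.
Implicit Types (p q : quat R) (u v : quat2 R) (z w : cplx R).

Lemma rmulDl u v q : rmul (u + v) q = rmul u q + rmul v q.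
Proof. by rewrite /rmul /= !mulrDl. Qed.

Lemma rmulDr v p q : rmul v (p + q) = rmul v p + rmul v q.
Proof. by rewrite /rmul /= !mulrDr. Qed.

Lemma rmulA v p q : rmul (rmul v p) q = rmul v (p * q).
Proof. by rewrite /rmul /= !mulrA. Qed.

Lemma rmulv1 v : rmul v 1 = v.
Proof. by case: v => a b; rewrite /rmul /= !mulr1. Qed.

Lemma rmulv0 v : rmul v 0 = 0.
Proof. by case: v => a b; rewrite /rmul /= !mulr0. Qed.

Lemma rmul0v q : rmul 0 q = 0 :> quat2 R.
Proof. by rewrite /rmul /= !mul0r. Qed.

Lemma rmulvN v q : rmul v (- q) = - rmul v q.
Proof. by rewrite /rmul /= !mulrN. Qed.

Lemma rmulNv v q : rmul (- v) q = - rmul v q.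
Proof. by rewrite /rmul /= !mulNr. Qed.

Variables (phi : quat2 R) (F : quat R).

Local Notation psi0 := ((F, 1) : quat2 R).

(** The functional [v.1 - F * v.2] annihilates the line of [psi0] and takes the value [alpha] at
    [phi]. Dividing by [alpha] on the left extracts the coefficient of [phi]; the second components
    then give that of [psi0]. *)
Definition alpha := phi.1 - F * phi.2.
Definition pcoord v := alpha^-1 * (v.1 - F * v.2).
Definition qcoord v := v.2 - phi.2 * pcoord v.

Lemma pcoordD u v : pcoord (u + v) = pcoord u + pcoord v.
Proof. by rewrite /pcoord -mulrDr; congr (_ * _); rewrite /= mulrDr opprD addrACA. Qed.

Lemma qcoordD u v : qcoord (u + v) = qcoord u + qcoord v.
Proof. by rewrite /qcoord pcoordD mulrDr opprD addrACA. Qed.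

Lemma pcoord_rmul v q : pcoord (rmul v q) = pcoord v * q.
Proof. by rewrite /pcoord /= -mulrA mulrBl mulrA. Qed.

Lemma qcoord_rmul v q : qcoord (rmul v q) = qcoord v * q.
Proof. by rewrite /qcoord pcoord_rmul mulrA mulrBl. Qed.

(** If [alpha] vanished, [phi] would lie both in E and in L, and uniqueness of its decomposition
    would force [phi = 0]. Then E and Ej are zero, and the line of [psi0] alone does not contain (1,
    0). *)
Lemma splitting_alpha :
  direct_sum3 (complex_line phi) (times_j (complex_line phi)) (quat_line psi0) ->
  alpha != 0.
Proof.
move=> dec; have E0 : complex_line phi 0 by exists 0; rewrite //= c2q0 rmulv0.
have Ej0 : times_j (complex_line phi) 0 by exists 0; rewrite // rmul0v.
have L0 : quat_line psi0 0 by exists 0; rewrite // rmulv0.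
have Ephi : complex_line phi phi by exists 1; rewrite //= c2q1 rmulv1.
apply/eqP => /eqP; rewrite subr_eq0 => /eqP a0.
have Lphi : quat_line psi0 phi.
  by exists phi.2 => //; rewrite /rmul /= -a0 mul1r; case: (phi).
have [t [_ uni]] := dec phi.
have e1 := uni (phi, 0, 0) (And4 Ephi Ej0 L0 (_ : phi = phi + 0 + 0)).
have e2 := uni (0, 0, phi) (And4 E0 Ej0 Lphi (_ : phi = 0 + 0 + phi)).
have phi0 : phi = 0.
  have : (phi, 0, 0) = (0, 0, phi) :> quat2 R * quat2 R * quat2 R.
    by rewrite -e1 ?addr0// -e2 ?add0r ?addr0.
  by case.
have [[[a b] l] [[[z _ ea] [_ [z' _ <-] eb] [q _ el] /= e] _]] := dec (1, 0).
move: ea eb el e => /= <- <- <-; rewrite phi0 !rmul0v !add0r => -[e1' e2'].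
by move/eqP: e1'; rewrite -[q]mul1r -e2' mulr0 oner_eq0.
Qed.

Hypothesis alpha0 : alpha != 0.

Lemma alpha_unit : alpha \is a GRing.unit.
Proof. by rewrite quat_unitE. Qed.

Lemma pcoord_phi : pcoord phi = 1.
Proof. by rewrite /pcoord mulVr// alpha_unit. Qed.

Lemma qcoord_phi : qcoord phi = 0.
Proof. by rewrite /qcoord pcoord_phi mulr1 subrr. Qed.

Lemma pcoord_psi : pcoord psi0 = 0.
Proof. by rewrite /pcoord /= mulr1 subrr mulr0. Qed.

Lemma qcoord_psi : qcoord psi0 = 1.
Proof. by rewrite /qcoord pcoord_psi mulr0 subr0. Qed.

Lemma coordsK v : rmul phi (pcoord v) + rmul psi0 (qcoord v) = v.
Proof.
have h : alpha * pcoord v = v.1 - F * v.2 by rewrite /pcoord mulVKr// alpha_unit.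
rewrite /rmul /= /qcoord; move: (pcoord v) h => P h; case: v h => a b /= h.
congr (_, _); last by rewrite mul1r addrC subrK.
by rewrite mulrBr mulrA addrCA -mulrBl h addrC subrK.
Qed.

Lemma pcoordE p q : pcoord (rmul phi p + rmul psi0 q) = p.
Proof.
by rewrite pcoordD !pcoord_rmul pcoord_phi pcoord_psi mul1r mul0r addr0.
Qed.

Lemma qcoordE p q : qcoord (rmul phi p + rmul psi0 q) = q.
Proof.
by rewrite qcoordD !qcoord_rmul qcoord_phi qcoord_psi mul1r mul0r add0r.
Qed.

Lemma proj_alongE (A B : set (quat2 R)) v a : A a -> B (v - a) ->
  (forall a', A a' -> B (v - a') -> a' = a) -> proj_along A B v = a.
Proof.
by move=> Aa Ba uni; apply: xget_unique => // a' [] /=; exact: uni.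
Qed.

Local Notation E := (complex_line phi).
Local Notation L := (quat_line psi0).

Lemma E_cpart p : E (rmul phi (cpart p)).
Proof. by rewrite cpartE; eexists. Qed.

Lemma Ej_jpart p : times_j E (rmul phi (jpart p)).
Proof. by rewrite jpartE -rmulA; eexists; [eexists|]. Qed.

Lemma proj_E_coord v :
  proj_along E (set_add (times_j E) L) v = rmul phi (cpart (pcoord v)).
Proof.
apply: proj_alongE; first exact: E_cpart.
  exists (rmul phi (jpart (pcoord v))); first exact: Ej_jpart.
  exists (rmul psi0 (qcoord v)); first by eexists.
  apply/eqP; rewrite eq_sym subr_eq addrAC -rmulDr [X in rmul _ X]addrC.
  by rewrite cjpart coordsK.
move=> a' [z _ /= <-] [_ [_ [w _ <-] <-] [_ [q _ <-] /= e]].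
have -> : v = rmul phi (c2q z + c2q w * qj R) + rmul psi0 q.
  by apply/eqP; rewrite rmulDr -addrA addrC -subr_eq -e rmulA.
by rewrite pcoordE cpartD cpart_c2q cpart_c2qj addr0.
Qed.

Lemma proj_Ej_coord v :
  proj_along (times_j E) (set_add E L) v = rmul phi (jpart (pcoord v)).
Proof.
apply: proj_alongE; first exact: Ej_jpart.
  exists (rmul phi (cpart (pcoord v))); first exact: E_cpart.
  exists (rmul psi0 (qcoord v)); first by eexists.
  apply/eqP; rewrite eq_sym subr_eq addrAC -rmulDr.
  by rewrite cjpart coordsK.
move=> a' [_ [z _ <-] <-] [_ [w _ <-] [_ [q _ <-] /= e]].
have -> : v = rmul phi (c2q w + c2q z * qj R) + rmul psi0 q.
  by rewrite rmulDr addrAC e -rmulA subrK.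
by rewrite pcoordE jpartD jpart_c2q jpart_c2qj add0r rmulA.
Qed.

Lemma proj_L_coord v :
  proj_along L (set_add E (times_j E)) v = rmul psi0 (qcoord v).
Proof.
apply: proj_alongE; first by eexists.
  exists (rmul phi (cpart (pcoord v))); first exact: E_cpart.
  exists (rmul phi (jpart (pcoord v))); first exact: Ej_jpart.
  by apply/eqP; rewrite eq_sym subr_eq -rmulDr cjpart coordsK.
move=> a' [q _ <-] [_ [z _ <-] [_ [_ [w _ <-] <-] /= e]].
have -> : v = rmul phi (c2q z + c2q w * qj R) + rmul psi0 q.
  by apply/eqP; rewrite -subr_eq -e rmulDr rmulA.
by rewrite qcoordE.
Qed.

(** The dressing matrix in coordinates: z = gamma and w = sigma give r_lambda, the inverse scalars
    give its inverse, and z = conj rho / rho with w = 0 gives its limit at infinity. *)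
Definition split_map z w v :=
  rmul phi (cpart (pcoord v) * c2q z + jpart (pcoord v)) +
  rmul psi0 (qcoord v * c2q w).

Lemma split_map_comp z w z' w' v :
  split_map z w (split_map z' w' v) = split_map (z * z') (w * w') v.
Proof.
rewrite /split_map pcoordE qcoordE; move: (pcoord v) (qcoord v) => p q.
rewrite cpartD jpartD !cpart_mulr jpart_mulr cpart_id cpart_jpart jpart_cpart.
by rewrite jpart_id mul0r addr0 add0r -!mulrA -!c2qM (mulrC z') (mulrC w').
Qed.

Lemma split_map1 v : split_map 1 1 v = v.
Proof. by rewrite /split_map c2q1 !mulr1 cjpart coordsK. Qed.

Lemma split_mapK z w : z != 0 -> w != 0 ->
  cancel (split_map z w) (split_map z^-1 w^-1).
Proof. by move=> z0 w0 v; rewrite split_map_comp !mulVf// split_map1. Qed.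

Lemma split_map_bij z w : z != 0 -> w != 0 -> bijective (split_map z w).
Proof.
move=> z0 w0; exists (split_map z^-1 w^-1); first exact: split_mapK.
by move=> v; rewrite split_map_comp !mulfV// split_map1.
Qed.

End Splitting.

(** * Limits in the spectral parameter *)

Section Limits.
Variable R : realType.
Implicit Types (z w rho : cplx R) (v : quat2 R).

(** Real linearity in [z] reduces limits of complex scalars to limits of their real and imaginary
    parts. *)
Lemma rmul_c2q_scale v z : rmul v (c2q z) =
  complex.Re z *: v + complex.Im z *: rmul v (c2q 'i%C).
Proof.
case: z v => a b [x y] /=; rewrite /rmul /=; congr (_, _);
by apply: quatP; rewrite ![in RHS]mxE !quat_mulE /qmul !mkqE /=; ring.
Qed.

(** The norm of [cplx R] takes its values in [cplx R] itself, so real radii are transported along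
    the embedding of R. *)
Lemma contraction_continuous (h : cplx R -> R) :
  (forall z w, h z - h w = h (z - w)) -> (forall z, (`|h z|%:C)%C <= `|z|) ->
  continuous h.
Proof.
move=> hB hle z; have FF : Filter (nbhs z) := nbhs_filter z.
apply/(@cvgrPdist_lt _ _ _ _ FF) => e e0.
have e0' : 0 < (e%:C)%C :> cplx R by rewrite ltcR.
apply: (@filterS _ (nbhs z) FF _ _ _ (nbhsx_ballx z _ e0')) => w.
rewrite -ball_normE /= => hzw.
by rewrite -ltcR; apply: le_lt_trans hzw; rewrite hB.
Qed.

Lemma Re_continuous : continuous (@complex.Re R : cplx R -> R).
Proof.
apply: contraction_continuous => [[a b] [c d] //|z]; exact: normc_ge_Re.
Qed.

Lemma Im_continuous : continuous (@complex.Im R : cplx R -> R).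
Proof.
apply: contraction_continuous => [[a b] [c d] //|z].
rewrite normc_def lecR -sqrtr_sqr ler_wsqrtr// lerDr; exact: sqr_ge0.
Qed.

Lemma cvg_rmul_c2q T (F : set_system T) (FF : Filter F) (h : T -> cplx R) z v :
  h t @[t --> F] --> z -> rmul v (c2q (h t)) @[t --> F] --> rmul v (c2q z).
Proof.
move=> hz; rewrite rmul_c2q_scale.
under eq_fun do rewrite rmul_c2q_scale.
apply: cvgD; apply: cvgZr_tmp.
- by apply: (cvg_comp _ _ hz (@Re_continuous z)).
- by apply: (cvg_comp _ _ hz (@Im_continuous z)).
Qed.

Global Instance cinfty_filter : ProperFilter (@cinfty R).
Proof.
apply: Build_ProperFilter_ex.
  move=> A [r hr]; exists ((`|r| + 1)%:C)%C; apply: hr.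
  have r1 : 0 <= `|r| + 1 by rewrite addr_ge0.
  rewrite ger0_norm ?lecR// ltcR; apply: le_lt_trans (ler_norm r) _.
  by rewrite ltrDl.
split.
- by exists 0.
- move=> A B [r hr] [s hs]; exists (Num.max r s) => z hz; split.
  + by apply: hr; apply: le_lt_trans hz; rewrite lecR le_max lexx.
  + by apply: hs; apply: le_lt_trans hz; rewrite lecR le_max lexx orbT.
- by move=> A B AB [r hr]; exists r => z /hr /AB.
Qed.

Lemma sigma_cvg rho : sigma_rho rho lambda @[lambda --> @cinfty R] --> (0 : cplx R).
Proof.
apply/cvgrPdist_lt => e e0.
(* Beyond this radius the denominator of sigma has modulus larger than |rho| / e. *)
pose b : cplx R := `|rho| + `|rho| / e.
have br : b \is Num.real by apply: ger0_real; rewrite addr_ge0// divr_ge0// ltW.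
exists (complex.Re b) => z; rewrite RRe_real// => hz; rewrite /= sub0r normrN.
rewrite /sigma_rho normrM normfV norm_conjC.
have lb : `|rho| / e < `|Num.conj rho - z|.
  rewrite distrC -(ltrD2l `|rho|); apply: lt_le_trans hz _.
  by rewrite addrC -(norm_conjC rho); have := ler_normD (z - Num.conj rho) (Num.conj rho);
    rewrite subrK.
have p0 : 0 < `|Num.conj rho - z|.
  by apply: le_lt_trans lb; rewrite divr_ge0// ltW.
by rewrite ltr_pdivrMr// mulrC -ltr_pdivrMr.
Qed.

Lemma gamma_cvg rho : rho != 0 ->
  gamma_rho rho lambda @[lambda --> @cinfty R] --> (Num.conj rho / rho : cplx R).
Proof.
move=> rho0.
(* Partial fractions express gamma as an affine function of sigma, whose limit is 0. *)
have E : \forall z \near @cinfty R, Num.conj rho / rho + (rho - Num.conj rho) / rho *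
    sigma_rho rho z = gamma_rho rho z.
  exists (complex.Re `|rho|) => z; rewrite RRe_real ?normr_real// => hz.
  have n0 : Num.conj rho - z != 0.
    apply: contraTneq hz => /eqP; rewrite subr_eq0 => /eqP <-.
    by rewrite norm_conjC ltxx.
  by rewrite /gamma_rho /sigma_rho; field; rewrite rho0 n0.
apply: cvg_trans (near_eq_cvg E) _.
have H : Num.conj rho / rho + (rho - Num.conj rho) / rho * sigma_rho rho z
    @[z --> @cinfty R] --> Num.conj rho / rho + (rho - Num.conj rho) / rho * 0.
  by apply: cvgD; [exact: cvg_cst|apply: cvgMl_tmp; exact: sigma_cvg].
by rewrite mulr0 addr0 in H.
Qed.

End Limits.

(** [gauge] inverts by [pinv]; a two-sided inverse identifies this choice. *)
Lemma pinv_cancel (T : pointedType) (g h : T -> T) :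
  cancel g h -> cancel h g -> pinv setT g = h.
Proof.
move=> gK hK; apply/funext => v; rewrite -[LHS]gK pinvK// inE.
by exists (h v).
Qed.

(** Bookkeeping for the gauge identity: [A] and [C] are terms along phi, the other four are terms
    along psi. *)
Lemma zmod_shuffle (V : zmodType) (A B C D G H : V) :
  A - B + (C - D + G) + H = A + C + (G - D + (H - B)).
Proof.
rewrite -!addrA; congr (_ + _); rewrite addrCA; congr (_ + _).
rewrite [RHS]addrCA addrCA; congr (_ + _).
by rewrite addrC addrA.
Qed.

Lemma zmod_shuffle2 (V : zmodType) (A B C D G H : V) :
  A - B + (C - D + G) - H = A + C - H + (G - D - B).
Proof. by rewrite zmod_shuffle -[RHS]addrA [in RHS](addrCA (- H)). Qed.

Lemma rmul_sandwich_linear (R : realType) (v : quat2 R) (k l q m m' : quat R) (b : R) :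
  - rmul v (k * (l * (b *: m + m') * q)) =
  b *: - rmul v (k * (l * m * q)) + - rmul v (k * (l * m' * q)).
Proof.
rewrite mulrDr mulrDl mulrDr rmulDr opprD scalerN; congr (- _ + _).
by rewrite /rmul -quat_scalerAr -quat_scalerAl -!quat_scalerAr.
Qed.

Lemma zmod_swap (V : zmodType) (A B C D : V) : A + B + (C + D) = D + B + (C + A).
Proof. by rewrite (addrC (A + B)) addrACA addrC. Qed.

(** The symmetry in X and Y behind closedness, with [A] for beta. The psi term is symmetric by
    [wX * dY = wY * dX]. Along phi, the second derivative [h] is common to both sides, the term with
    [pv] is symmetric by [dX * wY = dY * wX], and the two remaining terms are exchanged. *)
Lemma closed_form_algebra (R : realType) (v psi0 : quat2 R)
    (al r r' A dX dY wX wY h q pv : quat R) :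
  al != 0 -> r * r' = 1 -> dX * wY = dY * wX -> wX * dY = wY * dX ->
  rmul (- rmul psi0 (wX * al * r)) (r' * (al^-1 * dY * q)) +
    rmul v (r' * ((al^-1 * dX * A * al^-1 * dY + al^-1 * h) * q +
      al^-1 * dY * (wX * al * r * pv + A * (al^-1 * dX * q)))) =
  rmul (- rmul psi0 (wY * al * r)) (r' * (al^-1 * dX * q)) +
    rmul v (r' * ((al^-1 * dY * A * al^-1 * dX + al^-1 * h) * q +
      al^-1 * dX * (wY * al * r * pv + A * (al^-1 * dY * q)))).
Proof.
move=> al0 rr' e1 e2; have ua : al \is a GRing.unit by rewrite quat_unitE.
have c1 w d :
  rmul (- rmul psi0 (w * al * r)) (r' * (al^-1 * d * q)) = - rmul psi0 (w * d * q).
  by rewrite rmulNv rmulA -!mulrA (mulrA r) rr' mul1r (mulVKr ua).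
rewrite !c1 e2; congr (_ + rmul _ (_ * _)).
rewrite !mulrDl !(mulrDr (_ * _)) !mulrA.
rewrite -[al^-1 * dY * wX]mulrA -e1 !mulrA.
exact: zmod_swap.
Qed.

(** * Conformality, quotients and lines under quaternionic factors *)

Section Sandwich.
Variables (R : realType) (S : riemann_surface R).

Lemma conformal_sandwich (g g0 : S -> quat R) x (k l : quat R) : k != 0 -> l != 0 ->
  (forall c X, atlas c -> dom c x -> dform g c x X = k * dform g0 c x X * l) ->
  conformal_immersion_at g0 x -> conformal_immersion_at g x.
Proof.
move=> k0 l0 e conf c ac dx; have [r r0 hr] := conf c ac dx.
exists (dot k k * dot l l * r) => [|X Y]; first by rewrite !mulr_gt0// dot_gt0.
by rewrite (e c X ac dx) (e c Y ac dx) dot_sandwich hr mulrA.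
Qed.

Lemma smooth_continuous (V : normedModType R) (s : S -> V) x :
  smooth_on setT s -> {for x, continuous s}.
Proof.
move=> sm; have [c ac dx] := atlas_cover x.
have c1 : {for coord c x, continuous (s \o param c)}.
  by apply: (Ck_continuous (smooth_chart sm ac 0)); exact: coord_image.
have e : \forall y \near x, s (param c (coord c y)) = s y.
  have : nbhs x (dom c).
    by apply: open_nbhs_nbhs; split=> //; exact: (Defs.dom_open (atlas_chart ac)).
  by apply: filterS => y dy; rewrite (coordK (atlas_chart ac) dy).
have c2 : (s \o param c) \o coord c @ x --> s x.
  rewrite -(nbhs_singleton e).
  by apply: (continuous_comp (coord_continuous_at ac dx)); exact: c1.
by apply: cvg_trans c2; apply: near_eq_cvg; exact: e.
Qed.

Lemma open_neq0 (s : S -> quat R) : (forall x, {for x, continuous s}) ->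
  open [set x | s x != 0].
Proof.
move=> cs; rewrite openE => x sx.
exact: (@cvgr_neq0 _ _ _ _ _ s (s x) (cs x) sx).
Qed.

Lemma smooth_on_quotient (s t : S -> quat R) :
  (forall k c, atlas c -> Ck k (chart_image c) (s \o param c)) ->
  (forall k c, atlas c -> Ck k (chart_image c) (t \o param c)) ->
  open [set x | t x != 0] ->
  smooth_on [set x | t x != 0] (fun x => s x * (t x)^-1).
Proof.
move=> ss st oU c ac k; have oW := open_subimage ac oU.
have sub : coord c @` (dom c `&` [set x | t x != 0]) `<=` chart_image c.
  by move=> _ [y [dy _] <-]; exists y.
apply: Ck_qM => //; first exact: (Ck_sub sub (ss k c ac)).
apply: Ck_qV => //; last exact: (Ck_sub sub (st k c ac)).
by move=> _ [y [dy ty] <-]; rewrite (coordK (atlas_chart ac) dy).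
Qed.

Lemma quat_line_rmul (v : quat2 R) q : q != 0 -> quat_line (rmul v q) = quat_line v.
Proof.
move=> q0; apply/seteqP; split=> [_ [p _ <-]|_ [p _ <-]].
  by exists (q * p); rewrite // rmulA.
by exists (q^-1 * p); rewrite // rmulA mulVKr// quat_unitE.
Qed.

End Sandwich.

(** * The Darboux transform *)

Section Darboux.
Variables (R : realType) (S : riemann_surface R) (F fd : S -> quat R).
Variables (rho : cplx R) (phi : S -> quat2 R).
Hypotheses (sF : smooth_on setT F) (sfd : smooth_on setT fd) (sphi : smooth_on setT phi).
Hypothesis par : eq_form (assoc_family (assoc_form F fd) rho phi) (fun _ _ _ => 0).

Local Notation E := (fun x => complex_line (phi x)).
Local Notation L := (line_bundle F).
Local Notation a x := (alpha (phi x) (F x)).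
Local Notation pc x := (pcoord (phi x) (F x)).
Local Notation qc x := (qcoord (phi x) (F x)).
Local Notation rq := (c2q rho).

Hypothesis rho0 : rho != 0.
Hypothesis a0 : forall x, a x != 0.

Lemma simple_factorE lambda x v : simple_factor rho E L lambda x v =
  split_map (phi x) (F x) (gamma_rho rho lambda) (sigma_rho rho lambda) v.
Proof.
rewrite /simple_factor /proj_E /proj_Ej /proj_L /line_bundle /psi.
rewrite proj_E_coord// proj_Ej_coord// proj_L_coord//.
by rewrite !rmulA -rmulDr.
Qed.

(** As eta vanishes on L, it factors through the coefficient of phi alone. *)
Lemma assoc_form_coord c x X v :
  assoc_form F fd c x X v = rmul (F x, 1) (dform fd c x X * (a x * pc x v)).
Proof.
have -> : a x * pc x v = v.1 - F x * v.2 by rewrite mulVKr// alpha_unit.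
by rewrite /assoc_form /rmul /= mul1r !mulrBr !mulrA.
Qed.

Lemma is_derive_rmul (v : plane R -> quat2 R) (q : plane R -> quat R) u X dv dq :
  is_derive u X v dv -> is_derive u X q dq ->
  is_derive u X (fun z => rmul (v z) (q z)) (rmul dv (q u) + rmul (v u) dq).
Proof.
move=> hv hq; apply: is_derive_pair.
  exact: is_derive_qM (is_derive_fst hv) hq.
exact: is_derive_qM (is_derive_snd hv) hq.
Qed.

Lemma is_derive_cpart (q : plane R -> quat R) u X (dq : quat R) :
  is_derive u X q dq -> is_derive u X (fun z => cpart (q z)) (cpart dq).
Proof.
move=> hq; have h i := @is_derive_quat_coord R q u X dq i hq.
apply: is_derive_quat; rewrite !mkqE;
  (under [X in is_derive _ _ X]funext => z do rewrite !mkqE) => //;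
  exact: is_derive_cst.
Qed.

Lemma is_derive_jpart (q : plane R -> quat R) u X (dq : quat R) :
  is_derive u X q dq -> is_derive u X (fun z => jpart (q z)) (jpart dq).
Proof.
move=> hq; have h i := @is_derive_quat_coord R q u X dq i hq.
apply: is_derive_quat; rewrite !mkqE;
  (under [X in is_derive _ _ X]funext => z do rewrite !mkqE) => //;
  exact: is_derive_cst.
Qed.

(** * Differentials at a point of a chart, and the gauge identity *)

Section InChart.
Variables (c : chart R S) (x : S).
Hypotheses (ac : atlas c) (dx : dom c x).
Implicit Types X : plane R.
Local Notation u := (coord c x).
Local Notation p := (param c).
Local Notation dF X := (dform F c x X).
Local Notation w X := (dform fd c x X).

Lemma paramK_at : p u = x.
Proof. exact: (coordK (atlas_chart ac) dx). Qed.

Lemma is_derive_smooth (V : normedModType R) (s : S -> V) X : smooth_on setT s ->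
  is_derive u X (s \o p) (dform s c x X).
Proof. by move=> sm; apply/derivableP/diff_derivable/smooth_differentiable. Qed.

Lemma dphiE X : dform phi c x X = - rmul (F x, 1) (w X * a x * rq).
Proof.
have := @par c x X ac dx; rewrite /assoc_family assoc_form_coord pcoord_phi// mulr1.
by move/eqP; rewrite rmulA addr_eq0 => /eqP.
Qed.

Lemma is_derive_phi1 X :
  is_derive u X (fun z => (phi (p z)).1) (- (F x * (w X * a x * rq))).
Proof.
by have := is_derive_fst (is_derive_smooth X sphi); rewrite dphiE.
Qed.

Lemma is_derive_phi2 X : is_derive u X (fun z => (phi (p z)).2) (- (w X * a x * rq)).
Proof.
by have := is_derive_snd (is_derive_smooth X sphi); rewrite dphiE /= mul1r.
Qed.

Lemma is_derive_alpha X : is_derive u X (fun z => a (p z)) (- (dF X * (phi x).2)).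
Proof.
have := is_deriveB (is_derive_phi1 X)
  (is_derive_qM (is_derive_smooth X sF) (is_derive_phi2 X)).
by rewrite /= paramK_at mulrN opprD opprK addrCA addNr addr0.
Qed.

Lemma Ck_alpha k : Ck k (chart_image c) (fun z => a (p z)).
Proof.
have oc := open_image ac; have Cphi := smooth_chart sphi ac k.
apply: Ck_B => //; first exact: Ck_fst.
apply: Ck_qM => //; first exact: (smooth_chart sF ac k).
exact: Ck_snd.
Qed.

Lemma is_derive_alphaV X : is_derive u X (fun z => (a (p z))^-1)
  ((a x)^-1 * dF X * (phi x).2 * (a x)^-1).
Proof.
have ca : {for u, continuous (fun z => a (p z))}.
  by apply: (Ck_continuous (Ck_alpha 0)); exact: coord_image.
have au : a (p u) != 0 by rewrite paramK_at.
have := is_derive_qV au ca (is_derive_alpha X).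
by rewrite paramK_at mulrN mulNr opprK !mulrA.
Qed.

(** Existence suffices: in the gauge identity the derivatives of both coordinates of a section are
    carried along as unknowns and match on the two sides. *)
Lemma derivable_pcoord (s : S -> quat2 R) X : smooth_on setT s -> exists dP,
  is_derive u X (fun z => pc (p z) (s (p z))) dP.
Proof.
move=> sm; have hs := is_derive_smooth X sm; eexists.
apply: is_derive_qM (is_derive_alphaV X) _.
apply: is_deriveB (is_derive_fst hs) _.
exact: is_derive_qM (is_derive_smooth X sF) (is_derive_snd hs).
Qed.

Lemma derivable_qcoord (s : S -> quat2 R) X : smooth_on setT s -> exists dQ,
  is_derive u X (fun z => qc (p z) (s (p z))) dQ.
Proof.
move=> sm; have hs := is_derive_smooth X sm.
have [dP hP] := derivable_pcoord X sm; eexists.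
apply: is_deriveB (is_derive_snd hs) _.
exact: is_derive_qM (is_derive_phi2 X) hP.
Qed.

Lemma is_derive_psi X : is_derive u X (fun z => (F (p z), 1) : quat2 R) (dF X, 0).
Proof. by apply: is_derive_pair (is_derive_smooth X sF) _; exact: is_derive_cst. Qed.

(** The relation phi = e alpha + psi beta solved for e. It is needed because d psi = e dF. *)
Lemma psi0_coords q : rmul (q, 0) 1 =
  rmul (phi x) ((a x)^-1 * q) - rmul (F x, 1) ((phi x).2 * ((a x)^-1 * q)).
Proof.
have := coordsK (a0 x) (q, 0); rewrite /qcoord /pcoord /= mulr0 subr0 sub0r.
by rewrite rmulvN rmulv1 => ->.
Qed.

(** The L-part of [s] is psi q, and d(psi q) = e dF q + psi dq. The projections to E and Ej kill psi
    dq, so no derivative of [s] survives. The phi-coordinate of e dF q is alpha^-1 dF q; rho^-1 on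
    its complex part and (conj rho)^-1 on its j-part amount to rho^-1 from the left. *)
Lemma eta_hat_opE (s : S -> quat2 R) X : smooth_on setT s ->
  eta_hat_op rho E L s c x X =
  - rmul (phi x) (c2q rho^-1 * ((a x)^-1 * dF X * qc x (s x))).
Proof.
move=> sm; have [dQ hQ] := derivable_qcoord X sm.
have hL := is_derive_rmul (is_derive_psi X) hQ.
rewrite /eta_hat_op /proj_E /proj_Ej /line_bundle /psi.
rewrite (_ : dform _ c x X = rmul (dF X, 0) (qc x (s x)) + rmul (F x, 1) dQ); last first.
  rewrite /dform (_ : _ \o p = fun z => rmul (F (p z), 1) (qc (p z) (s (p z)))).
    by rewrite (@derive_val _ _ _ _ _ _ _ hL) paramK_at.
  by apply/funext => z /=; rewrite /proj_L proj_L_coord.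
rewrite proj_E_coord// proj_Ej_coord//.
have -> : pc x (rmul (dF X, 0) (qc x (s x)) + rmul (F x, 1) dQ) =
    (a x)^-1 * dF X * qc x (s x).
  by rewrite pcoordD !pcoord_rmul pcoord_psi mul0r addr0 /pcoord /= mulr0 subr0.
rewrite !rmulA -rmulDr; congr (- rmul _ _).
rewrite cpart_comm -fmorphV jpart_comm -mulrDr; congr (_ * _).
exact: cjpart.
Qed.

Lemma eta_hatE v X : eta_hat rho E L c x X v =
  - rmul (phi x) (c2q rho^-1 * ((a x)^-1 * dF X * qc x v)).
Proof. by apply: eta_hat_opE => c' ac' k; exact: Ck_cst. Qed.

Lemma sigmaV lambda : (sigma_rho rho lambda)^-1 = 1 - lambda * (Num.conj rho)^-1.
Proof. by rewrite /sigma_rho invf_div mulrBl divff// conjC_eq0. Qed.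

Lemma sigmaV_gamma lambda : lambda != Num.conj rho ->
  (sigma_rho rho lambda)^-1 * gamma_rho rho lambda = 1 - lambda / rho.
Proof.
move=> l2; have c0 : Num.conj rho != 0 by rewrite conjC_eq0.
by rewrite /sigma_rho /gamma_rho; field; rewrite rho0 c0 subr_eq0 eq_sym l2.
Qed.

Lemma gammaV_sigma lambda : lambda != rho -> lambda != Num.conj rho ->
  (gamma_rho rho lambda)^-1 * (lambda - rho) * sigma_rho rho lambda = - rho.
Proof.
move=> l1 l2; have c0 : Num.conj rho != 0 by rewrite conjC_eq0.
rewrite /sigma_rho /gamma_rho; field.
by rewrite rho0 c0 !subr_eq0 !(eq_sym _ lambda) l1 l2.
Qed.

Lemma sigma_lambda lambda : lambda != Num.conj rho ->
  (lambda - Num.conj rho) * sigma_rho rho lambda = - Num.conj rho.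
Proof.
by move=> l2; rewrite /sigma_rho; field; rewrite subr_eq0 eq_sym l2.
Qed.

Lemma gamma_sigma_neq0 lambda : lambda != rho -> lambda != Num.conj rho ->
  gamma_rho rho lambda != 0 /\ sigma_rho rho lambda != 0.
Proof.
move=> l1 l2; have c0 : Num.conj rho != 0 by rewrite conjC_eq0.
rewrite /sigma_rho /gamma_rho; split; rewrite !mulf_eq0 !invr_eq0 ?mulf_eq0;
by rewrite (negbTE c0)
  ?(negbTE rho0) !subr_eq0 !(eq_sym _ lambda) ?(negbTE l1) (negbTE l2).
Qed.

(** For M = alpha^-1 dF q, the contribution of d(psi q) along phi: the inverse gauge multiplies q by
    sigma^-1 before differentiation, and r_lambda acts afterwards. The result is the ungauged term
    plus lambda times etahat. *)
Lemma phi_part lambda (M : quat R) : lambda != Num.conj rho ->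
  let ga := c2q (gamma_rho rho lambda) in
  let si := c2q (sigma_rho rho lambda)^-1 in
  cpart (M * si) * ga + jpart (M * si) = M - c2q rho^-1 * M * c2q lambda.
Proof.
move=> l2 ga si; rewrite cpart_mulr jpart_mulr -mulrA -c2qM sigmaV_gamma//.
rewrite /si sigmaV !(c2qD, c2qN, c2q1) !(mulrBr, mulr1) addrACA cjpart -opprD.
congr (_ - _); rewrite (mulrC lambda) (mulrC _ _^-1) !c2qM !mulrA.
rewrite cpart_comm -fmorphV jpart_comm -mulrDl -mulrDr.
by rewrite cjpart.
Qed.

(** Here P' is the phi-coordinate after the inverse gauge; [P' * lambda] comes from eta and
    [rho * P'] from d phi. The difference has the factor lambda - rho on the complex part and lambda
    - conj rho on the j-part, which cancel the poles of gamma^-1 and sigma. What remains is the term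
    of d phi in the ungauged differential. *)
Lemma psi_part lambda (P : quat R) : lambda != rho -> lambda != Num.conj rho ->
  let P' := cpart P * c2q (gamma_rho rho lambda)^-1 + jpart P in
  (P' * c2q lambda - rq * P') * c2q (sigma_rho rho lambda) = - (rq * P).
Proof.
move=> l1 l2 P'; have -> : P' * c2q lambda - rq * P' =
    cpart P * c2q ((gamma_rho rho lambda)^-1 * (lambda - rho)) +
    jpart P * c2q (lambda - Num.conj rho).
  set g := c2q (gamma_rho rho lambda)^-1.
  have e1 : cpart P * (g * rq) = rq * (cpart P * g).
    by rewrite -c2qM mulrC c2qM mulrA cpart_comm mulrA.
  rewrite /P' -/g c2qM -/g !(c2qD, c2qN) !mulrBr e1 jpart_comm.
  by rewrite mulrDl mulrDr opprD addrACA !mulrA.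
rewrite mulrDl -!mulrA -!c2qM gammaV_sigma// sigma_lambda//.
by rewrite !c2qN !mulrN cpart_comm jpart_comm -opprD -mulrDr cjpart.
Qed.

Lemma gaugeE lambda (s : S -> quat2 R) X : lambda != rho -> lambda != Num.conj rho ->
  smooth_on setT s ->
  gauge (simple_factor rho E L lambda) (assoc_family (assoc_form F fd) lambda) s c x X =
  assoc_family (eta_hat rho E L) lambda s c x X.
Proof.
move=> l1 l2 sm; have [g0 s0] := gamma_sigma_neq0 l1 l2.
set ga := gamma_rho rho lambda in g0 *; set si := sigma_rho rho lambda in s0 *.
have [dP hP] := derivable_pcoord X sm; have [dQ hQ] := derivable_qcoord X sm.
rewrite /gauge simple_factorE -/ga -/si.
have -> : (fun y => pinv setT (simple_factor rho E L lambda y) (s y)) =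
    (fun y => split_map (phi y) (F y) ga^-1 si^-1 (s y)).
  apply/funext => y; rewrite (_ : simple_factor _ _ _ _ y = split_map (phi y) (F y) ga si).
    rewrite (@pinv_cancel _ _ (split_map (phi y) (F y) ga^-1 si^-1))//.
      exact: split_mapK.
    by move=> v; rewrite split_map_comp// !mulfV// split_map1.
  by apply/funext => v; rewrite simple_factorE.
set s' := fun y => _.
set P := pc x (s x); set Q := qc x (s x).
pose P' := cpart P * c2q ga^-1 + jpart P; pose Q' := Q * c2q si^-1.
pose dP' := cpart dP * c2q ga^-1 + jpart dP; pose dQ' := dQ * c2q si^-1.
have Dc z : is_derive u X (cst (c2q z)) (0 : quat R) by exact: is_derive_cst.
have hP' : is_derive u X (fun z => cpart (pc (p z) (s (p z))) * c2q ga^-1 +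
    jpart (pc (p z) (s (p z)))) dP'.
  have := is_deriveD (is_derive_qM (is_derive_cpart hP) (Dc ga^-1)) (is_derive_jpart hP).
  by rewrite mulr0 addr0.
have hQ' : is_derive u X (fun z => qc (p z) (s (p z)) * c2q si^-1) dQ'.
  by have := is_derive_qM hQ (Dc si^-1); rewrite mulr0 addr0.
(* By parallelism d phi points along psi, and d psi = e dF; the vector e is expanded in phi and psi
   by [psi0] below. *)
have Ds : dform s c x X = rmul (phi x) dP - rmul (F x, 1) (dform fd c x X * a x * rq * P)
    + (rmul (dform F c x X, 0) Q + rmul (F x, 1) dQ).
  have hs := is_deriveD (is_derive_rmul (is_derive_smooth X sphi)
    hP) (is_derive_rmul (is_derive_psi X) hQ).
  rewrite /dform (_ : s \o p = fun z => rmul (phi (p z)) (pc (p z) (s (p z))) +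
      rmul (F (p z), 1) (qc (p z) (s (p z)))); last first.
    by apply/funext => z /=; rewrite coordsK.
  rewrite (@derive_val _ _ _ _ _ _ _ hs) /= paramK_at dphiE.
  by rewrite rmulNv rmulA [in LHS](addrC (- _)).
have Ds' : dform s' c x X =
    rmul (phi x) dP' - rmul (F x, 1) (dform fd c x X * a x * rq * P')
    + (rmul (dform F c x X, 0) Q' + rmul (F x, 1) dQ').
  have hs := is_deriveD (is_derive_rmul (is_derive_smooth X sphi)
    hP') (is_derive_rmul (is_derive_psi X) hQ').
  rewrite /dform (_ : s' \o p = fun z => rmul (phi (p z)) (cpart (pc (p z) (s (p z))) *
      c2q ga^-1 + jpart (pc (p z) (s (p z)))) +
      rmul (F (p z), 1) (qc (p z) (s (p z)) * c2q si^-1)) //.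
  rewrite (@derive_val _ _ _ _ _ _ _ hs) /= paramK_at dphiE.
  by rewrite rmulNv rmulA [in LHS](addrC (- _)).
have pc' : pc x (s' x) = P' by rewrite /s' /split_map pcoordE.
have psi0 q : rmul (dform F c x X, 0) q = rmul (phi x) ((a x)^-1 * dform F c x X * q) -
    rmul (F x, 1) ((phi x).2 * ((a x)^-1 * dform F c x X) * q).
  by rewrite -[rmul (dform F c x X, 0) q]rmulv1 rmulA mulr1
     -[(dform F c x X, 0)]rmulv1 psi0_coords rmulDl rmulNv !rmulA.
rewrite /assoc_family assoc_form_coord pc' Ds Ds' eta_hatE !psi0 -/Q.
set mm := (a x)^-1 * dform F c x X; set ww := dform fd c x X.
(* The two coordinates of d_lambda applied to r_lambda^-1 s. [phi_part] and [psi_part] then evaluate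
   the action of gamma and sigma on them. *)
have -> : rmul (phi x) dP' - rmul (F x, 1) (ww * a x * rq * P') +
   (rmul (phi x) (mm * Q') - rmul (F x, 1) ((phi x).2 * mm * Q') + rmul (F x, 1) dQ') +
   rmul (rmul (F x, 1) (ww * (a x * P'))) (c2q lambda) =
   rmul (phi x) (dP' + mm * Q') + rmul (F x, 1) (dQ' - (phi x).2 * mm * Q' +
     ww * a x * (P' * c2q lambda - rq * P')).
  rewrite (zmod_shuffle (rmul (phi x) dP')) rmulA -!rmulDr -!rmulvN -!rmulDr.
  by rewrite (mulrBr (ww * a x)) !mulrA.
rewrite /split_map pcoordE// qcoordE//.
have -> : cpart (dP' + mm * Q') * c2q ga + jpart (dP' + mm * Q') =
    dP + (mm * Q - c2q rho^-1 * (mm * Q) * c2q lambda).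
  have e : mm * Q' = mm * Q * c2q si^-1 by exact: mulrA.
  have h1 : cpart dP' * c2q ga + jpart dP' = dP.
    rewrite /dP' cpartD jpartD cpart_mulr jpart_mulr cpart_id cpart_jpart jpart_cpart.
    by rewrite jpart_id mul0r add0r addr0 -mulrA -c2qM mulVf// mulr1 cjpart.
  rewrite e (cpartD dP') (jpartD dP') (mulrDl (cpart dP')) -(phi_part _ l2) -[in RHS]h1.
  exact: addrACA.
have -> : (dQ' - (phi x).2 * mm * Q' + ww * a x * (P' * c2q lambda - rq * P')) * c2q si =
    dQ - (phi x).2 * mm * Q - ww * a x * rq * P.
  rewrite mulrDl mulrBl -[ww * a x * _ * _]mulrA psi_part// mulrN !mulrA.
  by rewrite /dQ' /Q' -!mulrA -!c2qM mulVf// !mulr1.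
rewrite rmulNv rmulA -mulrA.
rewrite (zmod_shuffle2 (rmul (phi x) dP)) -!rmulvN -!rmulDr.
by rewrite addrA.
Qed.

End InChart.

(** * The dressed form is a retraction form *)

Lemma eta_hat_chart c v X z : atlas c -> chart_image c z ->
  eta_hat rho E L c (param c z) X v =
  - rmul (phi (param c z)) (c2q rho^-1 *
      ((a (param c z))^-1 * 'D_X (F \o param c) z * qc (param c z) v)).
Proof.
move=> ac iz; have [dz ez] := param_dom ac iz.
apply: (etrans (eta_hatE ac dz v X)).
by rewrite /dform ez.
Qed.

Lemma Ck_eta_hat c v X k : atlas c ->
  Ck k (chart_image c) (fun z => eta_hat rho E L c (param c z) X v).
Proof.
move=> ac; have oc := open_image ac; have Cphi := smooth_chart sphi ac k.
have C1 : Ck k (chart_image c) (fun z => (phi (param c z)).1).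
  exact: (Ck_fst oc Cphi).
have C2 : Ck k (chart_image c) (fun z => (phi (param c z)).2).
  exact: (Ck_snd oc Cphi).
have CF : Ck k (chart_image c) (fun z => F (param c z)) by exact: (smooth_chart sF ac k).
have CDF : Ck k (chart_image c) ('D_X (F \o param c)).
  by have [_ /(_ X)] := smooth_chart sF ac k.+1.
have Ca := Ck_alpha ac k.
have CaV : Ck k (chart_image c) (fun z => (a (param c z))^-1) by exact: Ck_qV.
have Cq : Ck k (chart_image c) (fun z => qc (param c z) v).
  apply: Ck_B => //; first exact: Ck_cst.
  apply: Ck_qM => //; apply: Ck_qM => //; apply: Ck_B => //; first exact: Ck_cst.
  by apply: Ck_qM => //; exact: Ck_cst.
have Cm : Ck k (chart_image c) (fun z => c2q rho^-1 *
      ((a (param c z))^-1 * 'D_X (F \o param c) z * qc (param c z) v)).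
  apply: Ck_qM => //; first exact: Ck_cst.
  by apply: Ck_qM => //; exact: Ck_qM.
have : Ck k (chart_image c) (fun z => - rmul (phi (param c z)) (c2q rho^-1 *
      ((a (param c z))^-1 * 'D_X (F \o param c) z * qc (param c z) v))).
  by apply: Ck_N => //; apply: Ck_pair => //; exact: Ck_qM.
by apply: Ck_congr => // z iz; rewrite eta_hat_chart.
Qed.

Lemma eta_hat_is_form v : is_form (fun c x X => eta_hat rho E L c x X v).
Proof.
split.
- move=> c x X Y b ac dx; rewrite !eta_hatE// dform_linear//.
  exact: rmul_sandwich_linear.
- move=> c c' x X ac ac' dx dx'.
  by rewrite (eta_hatE ac' dx') (eta_hatE ac dx) (dform_transition _ sF ac ac' dx dx').
- by move=> c X ac k; exact: Ck_eta_hat.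
Qed.

Hypotheses (w1 : wedge_eq0 (dform F) (dform fd)) (w2 : wedge_eq0 (dform fd) (dform F)).

Lemma eta_hat_closed v : closed_form (fun c x X => eta_hat rho E L c x X v).
Proof.
move=> c x X Y ac dx; have oc := open_image ac.
have ix := coord_image dx; have ex := paramK_at ac dx.
have nI : nbhs (coord c x) (chart_image c) by exact: open_nbhs_nbhs.
pose H X Y := 'D_X ('D_Y (F \o param c)) (coord c x).
have Hsym : H X Y = H Y X.
  by apply: (@derive_sym R 3 _ _ _ _ _ oc ix); exact: (smooth_chart sF ac 2).
have hG Z Z' : is_derive (coord c x) Z ('D_Z' (F \o param c)) (H Z Z').
  apply/derivableP/diff_derivable.
  by have [_ /(_ Z')[+ _]] := smooth_chart sF ac 2; apply.
have dE Z : is_derive (coord c x) Z (fun z => qc (param c z) v)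
    (dform fd c x Z * a x * rq * pc x v + (phi x).2 * ((a x)^-1 * dform F c x Z * qc x v)).
  have hc1 : is_derive (coord c x) Z (cst v.1) (0 : quat R) by exact: is_derive_cst.
  have hc2 : is_derive (coord c x) Z (cst v.2) (0 : quat R) by exact: is_derive_cst.
  have hp := is_derive_qM (is_derive_alphaV ac dx Z)
    (is_deriveB hc1 (is_derive_qM (is_derive_smooth ac dx Z sF) hc2)).
  have h := is_deriveB hc2 (is_derive_qM (is_derive_phi2 ac dx Z) hp).
  (* For constant [v] the coordinates satisfy dp = - alpha^-1 dF q; this is that relation multiplied
     by - beta. *)
  have alg (A ai d m v2 : quat R) :
      - (A * (ai * d * A * ai * m + ai * (0 - (d * v2 + F x * 0)))) =
      A * (ai * d * (v2 - A * (ai * m))).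
    by rewrite mulr0 addr0 sub0r -mulrN opprD mulrN opprK mulrBr addrC !mulrA.
  apply: (is_derive_eq h); rewrite /= !fctE /= ex sub0r opprD mulNr opprK alg.
  by rewrite /qcoord /pcoord.
(* Minus the derivative along [Z] of the value of the form on [Z']; closedness is the symmetry of
   [K]. *)
pose K Z Z' := (rmul (dform phi c x Z) (c2q rho^-1 *
      ((a x)^-1 * dform F c x Z' * qc x v)) +
    rmul (phi x) (c2q rho^-1 * (((a x)^-1 * dform F c x Z * (phi x).2 * (a x)^-1 *
      dform F c x Z' + (a x)^-1 * H Z Z') * qc x v +
      (a x)^-1 * dform F c x Z' * (dform fd c x Z * a x * rq * pc x v +
        (phi x).2 * ((a x)^-1 * dform F c x Z * qc x v))))).
have KE Z Z' : 'D_Z (fun z => eta_hat rho E L c (param c z) Z' v) (coord c x) = - K Z Z'.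
  rewrite (@near_eq_derive _ _ _ _ (fun z => - rmul (phi (param c z)) (c2q rho^-1 *
      ((a (param c z))^-1 * 'D_Z' (F \o param c) z * qc (param c z) v)))); last first.
    by apply: filterS nI => z iz; exact: eta_hat_chart.
  have hr : is_derive (coord c x) Z (cst (c2q rho^-1)) (0 : quat R).
    exact: is_derive_cst.
  have h := is_deriveN (is_derive_rmul (is_derive_smooth ac dx Z sphi)
    (is_derive_qM hr (is_derive_qM (is_derive_qM
      (is_derive_alphaV ac dx Z) (hG Z Z')) (dE Z)))).
  by rewrite (@derive_val _ _ _ _ _ _ _ h) /= ex mul0r add0r.
have KK : K X Y = K Y X.
  rewrite /K (dphiE ac dx X) (dphiE ac dx Y) Hsym.
  apply: closed_form_algebra.
  - exact: a0.
  - by rewrite -c2qM mulfV.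
  - by apply/eqP; rewrite -subr_eq0; apply/eqP; exact: (w1 X Y ac dx).
  - by apply/eqP; rewrite -subr_eq0; apply/eqP; exact: (w2 X Y ac dx).
exact: (etrans (KE X Y) (etrans (congr1 -%R KK) (esym (KE Y X)))).
Qed.

Lemma eta_hat_linear c x X v v' (q : quat R) : atlas c -> dom c x ->
  eta_hat rho E L c x X (rmul v q + v') =
  rmul (eta_hat rho E L c x X v) q + eta_hat rho E L c x X v'.
Proof.
move=> ac dx; rewrite !eta_hatE// qcoordD qcoord_rmul mulrDr mulrDr rmulDr opprD.
by rewrite rmulNv rmulA !mulrA.
Qed.

(** Since the image also lies in the line of phi, this yields both that the form squares to zero and
    that the new line bundle lies in its kernel. *)
Lemma eta_hat_phi c x X q : atlas c -> dom c x ->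
  eta_hat rho E L c x X (rmul (phi x) q) = 0.
Proof.
move=> ac dx; rewrite eta_hatE// qcoord_rmul qcoord_phi// mul0r !mulr0 rmulv0.
exact: oppr0.
Qed.

Lemma eta_hat_retraction : retraction_form (eta_hat rho E L).
Proof.
split.
- by move=> *; exact: eta_hat_linear.
- exact: eta_hat_is_form.
- exact: eta_hat_closed.
- move=> c x X Y v ac dx; rewrite [X in eta_hat _ _ _ _ _ _ X]eta_hatE//.
  by rewrite -rmulvN eta_hat_phi.
Qed.

(** * The Darboux transform as a surface, and its dual *)

Local Notation b x := ((phi x).2).

Lemma Ck_phi1 k c : atlas c -> Ck k (chart_image c) (fun z => (phi (param c z)).1).
Proof. by move=> ac; exact: (Ck_fst (open_image ac) (smooth_chart sphi ac k)). Qed.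

Lemma Ck_phi2 k c : atlas c -> Ck k (chart_image c) (fun z => (phi (param c z)).2).
Proof. by move=> ac; exact: (Ck_snd (open_image ac) (smooth_chart sphi ac k)). Qed.

Lemma phi1_continuous x : {for x, continuous (fun y => (phi y).1)}.
Proof.
have := @smooth_continuous R S _ phi x sphi => h.
exact: (cvg_comp phi fst h (@cvg_fst _ _ (nbhs (phi x).1) (nbhs (phi x).2) _)).
Qed.

Lemma phi2_continuous x : {for x, continuous (fun y => (phi y).2)}.
Proof.
have := @smooth_continuous R S _ phi x sphi => h.
exact: (cvg_comp phi snd h (@cvg_snd _ _ (nbhs (phi x).1) (nbhs (phi x).2) _)).
Qed.

Lemma affine_algebra (G w al r f1 f2 : quat R) : f2 != 0 -> al = f1 - G * f2 ->
  - (G * (w * al * r)) * f2^-1 + f1 * - (f2^-1 * - (w * al * r) * f2^-1) =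
  al * f2^-1 * w * (al * r * f2^-1).
Proof.
move=> f20 e; have uf : f2 \is a GRing.unit by rewrite quat_unitE.
have -> : al * f2^-1 = f1 * f2^-1 - G by rewrite e mulrBl mulrK.
by rewrite !mulrN !mulNr mulrN opprK !mulrBl !mulrA addrC.
Qed.

Lemma dform_affine c x X : atlas c -> dom c x -> b x != 0 ->
  dform (fun y => (phi y).1 * (phi y).2^-1) c x X =
  a x * (b x)^-1 * dform fd c x X * (a x * rq * (b x)^-1).
Proof.
move=> ac dx bx; have ex := paramK_at ac dx.
have cb : {for coord c x, continuous (fun z => b (param c z))}.
  by apply: (Ck_continuous (Ck_phi2 0 ac)); exact: coord_image.
have bu : b (param c (coord c x)) != 0 by rewrite ex.
have h := is_derive_qM (is_derive_phi1 ac dx X)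
  (is_derive_qV bu cb (is_derive_phi2 ac dx X)).
apply: (etrans (@derive_val _ _ _ _ _ _ _ h)); rewrite ex.
exact: affine_algebra.
Qed.

Lemma affine_algebra2 (G w al r f1 f2 : quat R) : f1 != 0 ->
  - (w * al * r) * f1^-1 + f2 * - (f1^-1 * - (G * (w * al * r)) * f1^-1) =
  (f2 * f1^-1 * G - 1) * w * (al * r * f1^-1).
Proof.
move=> f10; by rewrite !mulrN !mulNr mulrN opprK !mulrBl !mul1r !mulrA addrC.
Qed.

Lemma dform_affine_inv c x X : atlas c -> dom c x -> (phi x).1 != 0 ->
  dform (fun y => (phi y).2 * (phi y).1^-1) c x X =
  (b x * (phi x).1^-1 * F x - 1) * dform fd c x X * (a x * rq * (phi x).1^-1).
Proof.
move=> ac dx bx; have ex := paramK_at ac dx.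
have cb : {for coord c x, continuous (fun z => (phi (param c z)).1)}.
  by apply: (Ck_continuous (Ck_phi1 0 ac)); exact: coord_image.
have bu : (phi (param c (coord c x))).1 != 0 by rewrite ex.
have h := is_derive_qM (is_derive_phi2 ac dx X)
  (is_derive_qV bu cb (is_derive_phi1 ac dx X)).
apply: (etrans (@derive_val _ _ _ _ _ _ _ h)); rewrite ex.
exact: affine_algebra2.
Qed.

(** If the left factor vanished, then G = f1 f2^-1, which says that alpha is zero. *)
Lemma affine_inv_neq0 (G f1 f2 : quat R) : f1 != 0 -> f1 - G * f2 != 0 ->
  f2 * f1^-1 * G - 1 != 0.
Proof.
move=> f10; apply: contra_neq => /eqP; rewrite subr_eq0 => /eqP e.
have u1 : f1 \is a GRing.unit by rewrite quat_unitE.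
have f20 : f2 \is a GRing.unit.
  by rewrite quat_unitE; apply: contra_eq_neq e => ->; rewrite !mul0r eq_sym oner_neq0.
have -> : G = f1 * f2^-1.
  by apply: (mulrI (_ : f2 * f1^-1 \is a GRing.unit));
    rewrite ?unitrMl ?unitrV// e mulrA mulrVK// divrr.
by rewrite mulrVK// subrr.
Qed.

Hypotheses (hF : branched_conformal F) (hfd : branched_conformal fd).

(** In either affine coordinate the differential is dF^d between nonvanishing quaternions, so
    immersed points of F^d remain immersed. *)
Lemma darboux_surface : surface_HP1 (darboux phi).
Proof.
have rq0 : rq != 0 by rewrite c2q_eq0.
(* At a zero of [beta] the Darboux transform passes through infinity. *)
move=> x; case: (eqVneq (b x) 0) => [b0|b0].
  have f10 : (phi x).1 != 0.
    by apply: contra_neq (a0 x) => e; rewrite /alpha e b0 mulr0 subrr.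
  have oU := @open_neq0 R S (fun y => (phi y).1) phi1_continuous.
  exists [set y | (phi y).1 != 0], (fun y => (phi y).2 * (phi y).1^-1); split=> //.
    split.
      by apply: smooth_on_quotient => // k c; [exact: Ck_phi2|exact: Ck_phi1].
    move=> y _; apply: filterS (hfd.2 y I) => z hz f1z.
    apply: (conformal_sandwich _ _ (fun c X ac dz => dform_affine_inv X ac dz f1z) (hz I)).
      by apply: affine_inv_neq0 => //; exact: a0.
    by rewrite !quat_mulf_eq0 !negb_or a0 rq0 -quat_unitE unitrV.
  right => y f1y; rewrite -(quat_line_rmul _ f1y) /darboux; congr (quat_line _).
  by rewrite /rmul /= mul1r mulrVK ?quat_unitE//; case: (phi y).
have oU := @open_neq0 R S (fun y => (phi y).2) phi2_continuous.
exists [set y | (phi y).2 != 0], (fun y => (phi y).1 * (phi y).2^-1); split=> //.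
  split.
    by apply: smooth_on_quotient => // k c; [exact: Ck_phi1|exact: Ck_phi2].
  move=> y _; apply: filterS (hfd.2 y I) => z hz f2z.
  have f2V : (b z)^-1 != 0 by rewrite -quat_unitE unitrV.
  apply: (conformal_sandwich _ _ (fun c X ac dz => dform_affine X ac dz f2z) (hz I)).
    by rewrite quat_mulf_eq0 negb_or a0.
  by rewrite !quat_mulf_eq0 !negb_or a0 rq0.
left => y f1y; rewrite -(quat_line_rmul _ f1y) /darboux; congr (quat_line _).
by rewrite /rmul /= mul1r mulrVK ?quat_unitE//; case: (phi y).
Qed.

Lemma eta_hat_nontrivial : exists c x X v,
  [/\ atlas c, dom c x & eta_hat rho E L c x X v != 0].
Proof.
have [x0 _] := rs_nonempty S.
have [x _ /(_ I) conf] := not_isolated (hF.2 x0 I).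
have [c ac dx] := atlas_cover x.
have [r r0 hr] := conf c ac dx.
pose X : plane R := delta_mx 0 0.
have dF0 : dform F c x X != 0.
  rewrite -dot_eq0 hr mulf_neq0// gt_eqF//.
  rewrite dot2E !mxE /= mulr1 mulr0 addr0; exact: ltr01.
(* On psi the coordinate q is 1, so at an immersed point of F the value is a nonzero multiple of
   phi. *)
exists c, x, X, (F x, 1); split=> //; rewrite eta_hatE// qcoord_psi mulr1 oppr_eq0.
apply/eqP => /(congr1 (pc x)); rewrite pcoord_rmul pcoord_phi// mul1r.
have -> : pc x 0 = 0 by rewrite -(rmulv0 (phi x)) pcoord_rmul mulr0.
apply/eqP; rewrite !quat_mulf_eq0 !negb_or dF0 c2q_eq0 invr_eq0 rho0.
by rewrite -quat_unitE unitrV alpha_unit.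
Qed.

Lemma eta_hat_associated : associated_to (darboux phi) (eta_hat rho E L).
Proof.
split.
- exact: darboux_surface.
- exact: eta_hat_retraction.
- exact: eta_hat_nontrivial.
- move=> c x X v ac dx; rewrite (eta_hatE ac dx) -rmulvN.
  by eexists.
- by move=> c x X v ac dx [q _ <-]; exact: eta_hat_phi.
Qed.

Definition dual_darboux x := fd x + b x * c2q rho^-1 * (a x)^-1.

(** Because d beta = - dF^d alpha rho, differentiating the first factor of beta rho^-1 alpha^-1
    produces - dF^d, which cancels the differential of F^d. Only the derivative of alpha^-1 is
    left. *)
Lemma dual_algebra (w al r r' d B : quat R) : al != 0 -> r * r' = 1 ->
  w + ((- (w * al * r) * r' + B * 0) * al^-1 + B * r' * (al^-1 * d * B * al^-1)) =
  B * r' * al^-1 * d * (B * al^-1).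
Proof.
move=> al0 rr; have u : al \is a GRing.unit by rewrite quat_unitE.
by rewrite mulr0 addr0 !mulNr -!mulrA (mulrA r) rr mul1r (divrr u) mulr1 addNKr.
Qed.

Lemma dform_dual c x X : atlas c -> dom c x -> dform dual_darboux c x X =
  b x * c2q rho^-1 * (a x)^-1 * dform F c x X * (b x * (a x)^-1).
Proof.
move=> ac dx; have ex := paramK_at ac dx.
have hr : is_derive (coord c x) X (cst (c2q rho^-1)) (0 : quat R) by exact: is_derive_cst.
have h := is_deriveD (is_derive_smooth ac dx X sfd)
  (is_derive_qM (is_derive_qM (is_derive_phi2 ac dx X) hr)
  (is_derive_alphaV ac dx X)).
apply: (etrans (@derive_val _ _ _ _ _ _ _ h)); rewrite ex.
by apply: dual_algebra => //; rewrite -c2qM mulfV.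
Qed.

Lemma smooth_dual : smooth_on setT dual_darboux.
Proof.
move=> c ac k; rewrite setIT; have oc := open_image ac.
apply: Ck_D => //; first exact: (smooth_chart sfd ac k).
apply: Ck_qM => //.
  by apply: Ck_qM => //; [exact: (Ck_phi2 k ac)|exact: Ck_cst].
by apply: Ck_qV => //; exact: Ck_alpha.
Qed.

(** * A Darboux transform that avoids infinity, and its associated family *)

Section Affine.
Variable fh : S -> quat R.
Hypothesis hfh : forall x, darboux phi x = line_bundle fh x.

Lemma affine_coord x : b x != 0 /\ fh x = (phi x).1 * (b x)^-1.
Proof.
have [q _ e] : line_bundle fh x (phi x).
  by rewrite -hfh; exists 1; rewrite // rmulv1.
have e1 : (phi x).1 = fh x * b x by rewrite -e /= mul1r.
have b0 : b x != 0.
  by apply: contra_neq (a0 x) => b0; rewrite /alpha e1 b0 !mulr0 subrr.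
by rewrite e1 mulrK// quat_unitE.
Qed.

(** The inner factors alpha rho beta^-1 and beta rho^-1 alpha^-1 are mutually inverse, so the wedge
    product is dF^d wedge dF between invertible factors. In the opposite order the inner factors are
    beta alpha^-1 and alpha beta^-1. *)
Lemma wedge_algebra1 (w w' d d' al B r r' : quat R) : al != 0 -> B != 0 -> r * r' = 1 ->
  w * d' = w' * d ->
  al * B^-1 * w * (al * r * B^-1) * (B * r' * al^-1 * d' * (B * al^-1)) -
  al * B^-1 * w' * (al * r * B^-1) * (B * r' * al^-1 * d * (B * al^-1)) = 0.
Proof.
move=> al0 B0 rr e.
have ua : al \is a GRing.unit by rewrite quat_unitE.
have uB : B \is a GRing.unit by rewrite quat_unitE.
rewrite -!mulrA !(mulKr uB) !(mulrA r) rr !mul1r !(mulVKr ua).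
by rewrite (mulrA w) (mulrA w') e subrr.
Qed.

Lemma wedge_algebra2 (w w' d d' al B r r' : quat R) : al != 0 -> B != 0 ->
  d * w' = d' * w ->
  (B * r' * al^-1 * d * (B * al^-1)) * (al * B^-1 * w' * (al * r * B^-1)) -
  (B * r' * al^-1 * d' * (B * al^-1)) * (al * B^-1 * w * (al * r * B^-1)) = 0.
Proof.
move=> al0 B0 e.
have ua : al \is a GRing.unit by rewrite quat_unitE.
have uB : B \is a GRing.unit by rewrite quat_unitE.
rewrite -!mulrA !(mulKr ua) !(mulVKr uB).
by rewrite (mulrA d) (mulrA d') e subrr.
Qed.

Lemma dform_fh c x X : atlas c -> dom c x ->
  dform fh c x X = a x * (b x)^-1 * dform fd c x X * (a x * rq * (b x)^-1).
Proof.
move=> ac dx; rewrite -(dform_affine X ac dx (affine_coord x).1).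
by congr (dform _ c x X); apply/funext => y; case: (affine_coord y).
Qed.

Lemma dual_darboux_dual : dual_surface id fh dual_darboux.
Proof.
split.
- split; first exact: smooth_dual.
  move=> x _; apply: filterS (hF.2 x I) => y /(_ I) hy _.
  have b0 := (affine_coord y).1; have aV : (a y)^-1 != 0.
    by rewrite -quat_unitE unitrV alpha_unit.
  apply: (conformal_sandwich _ _ (fun c X ac dy => dform_dual X ac dy) hy).
    by rewrite !quat_mulf_eq0 !negb_or b0 aV c2q_eq0 invr_eq0 rho0.
  by rewrite !quat_mulf_eq0 !negb_or b0 aV.
- move=> c x X Y ac dx; rewrite /wedge.
  rewrite (dform_dual X ac dx) (dform_dual Y ac dx) (dform_fh X ac dx) (dform_fh Y ac dx).
  apply: wedge_algebra1; [exact: a0|exact: (affine_coord x).1|by rewrite -c2qM mulfV|].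
  by apply/eqP; rewrite -subr_eq0; apply/eqP; exact: (w2 X Y ac dx).
- move=> c x X Y ac dx; rewrite /wedge.
  rewrite (dform_dual X ac dx) (dform_dual Y ac dx) (dform_fh X ac dx) (dform_fh Y ac dx).
  apply: wedge_algebra2; [exact: a0|exact: (affine_coord x).1|].
  by apply/eqP; rewrite -subr_eq0; apply/eqP; exact: (w1 X Y ac dx).
Qed.

Lemma assoc_form_rmul (W g v1 v2 : quat R) :
  (g * W * v1 - g * W * g * v2, W * v1 - W * g * v2) = rmul (g, 1) (W * (v1 - g * v2)).
Proof. by rewrite /rmul /= mul1r !mulrBr !mulrA. Qed.

(** The new affine coordinate f1 B^-1 equals G + alpha B^-1, so B alpha^-1 (v1 - f1 B^-1 v2) = B
    alpha^-1 (v1 - G v2) - v2, which is minus the psi-coordinate of v. *)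
Lemma eta_algebra (al B r' d G v1 v2 f1 : quat R) : al != 0 -> B != 0 -> al = f1 - G * B ->
  B * r' * al^-1 * d * (B * al^-1) * (v1 - f1 * B^-1 * v2) =
  - (B * (r' * (al^-1 * d * (v2 - B * (al^-1 * (v1 - G * v2)))))).
Proof.
move=> al0 B0 e.
have ua : al \is a GRing.unit by rewrite quat_unitE.
have uB : B \is a GRing.unit by rewrite quat_unitE.
have -> : B * r' * al^-1 * d * (B * al^-1) * (v1 - f1 * B^-1 * v2) =
  B * (r' * (al^-1 * d * (B * (al^-1 * (v1 - f1 * B^-1 * v2))))) by rewrite !mulrA.
set Z := v2 - _.
have -> : - (B * (r' * (al^-1 * d * Z))) = B * (r' * (al^-1 * d * - Z)) by rewrite !mulrN.
rewrite /Z opprB; congr (_ * (_ * (_ * _))).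
have -> : f1 * B^-1 = al * B^-1 + G by rewrite e mulrBl mulrK// subrK.
rewrite mulrDl opprD addrCA addrC mulrDr mulrDr; congr (_ + _).
by rewrite !mulrN -!mulrA (mulKr ua) (mulVKr uB).
Qed.

Lemma eta_hat_assoc : eq_form (eta_hat rho E L) (assoc_form fh dual_darboux).
Proof.
move=> c x X ac dx; apply/funext => v.
rewrite (eta_hatE ac dx) /assoc_form assoc_form_rmul (dform_dual X ac dx).
have [b0 ef] := affine_coord x.
rewrite ef (eta_algebra _ _ _ _ (a0 x) b0 (erefl (a x))) rmulvN; congr (- _).
rewrite -/(pc x v) -/(qc x v) -[RHS]rmulA; congr (rmul _ _).
by rewrite /rmul /= mul1r mulrVK ?quat_unitE//; case: (phi x).
Qed.

End Affine.

(** * The dressing matrix at infinity, and the values extended by limits *)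

Lemma simple_factor_cvg x v : simple_factor rho E L lambda x v @[lambda --> @cinfty R] -->
  split_map (phi x) (F x) (Num.conj rho / rho) 0 v.
Proof.
have H z w : split_map (phi x) (F x) z w v =
    rmul (rmul (phi x) (cpart (pc x v))) (c2q z) + rmul (phi x) (jpart (pc x v)) +
    rmul (rmul (F x, 1) (qc x v)) (c2q w).
  by rewrite /split_map rmulDr !rmulA.
rewrite H; under eq_fun do rewrite simple_factorE H.
apply: cvgD; last by apply: cvg_rmul_c2q; exact: sigma_cvg.
apply: cvgD; last exact: cvg_cst.
by apply: cvg_rmul_c2q; exact: gamma_cvg.
Qed.

Lemma simple_factor_inftyE x v : simple_factor_infty rho E L x v =
  split_map (phi x) (F x) (Num.conj rho / rho) 0 v.
Proof.
apply: xget_unique; first exact: simple_factor_cvg.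
by move=> y /= hy; apply: norm_cvg_unique hy (@simple_factor_cvg x v).
Qed.

Lemma darboux_range x : darboux phi x = range (simple_factor_infty rho E L x).
Proof.
have z0 : Num.conj rho / rho != 0.
  by rewrite mulf_neq0 ?invr_eq0// conjC_eq0.
apply/seteqP; split=> [_ [q _ <-]|_ [v _ <-]].
  (* The limit is invertible on the line of phi, where it multiplies the complex part by conj rho /
     rho. Any second scalar would serve as well, since the psi-coordinate here is zero. *)
  exists (split_map (phi x) (F x) (Num.conj rho / rho)^-1 1 (rmul (phi x) q)) => //.
  rewrite simple_factor_inftyE split_map_comp// mulfV// mul0r.
  rewrite /split_map pcoord_rmul pcoord_phi// mul1r c2q1 c2q0 mulr1 mulr0 rmulv0 addr0.
  by rewrite cjpart.
by rewrite simple_factor_inftyE /split_map c2q0 mulr0 rmulv0 addr0; eexists.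
Qed.

Lemma eta_hat_op_order0 (s : S -> quat2 R) : smooth_on setT s ->
  eq_form (eta_hat_op rho E L s) (fun c x X => eta_hat rho E L c x X (s x)).
Proof.
move=> sm c x X ac dx; apply: (etrans (eta_hat_opE ac dx X sm)).
exact: (esym (eta_hatE ac dx (s x) X)).
Qed.

Lemma simple_factor_bij lambda x : lambda != rho -> lambda != Num.conj rho ->
  bijective (simple_factor rho E L lambda x).
Proof.
move=> l1 l2; have [g0 s0] := gamma_sigma_neq0 l1 l2.
rewrite (_ : simple_factor _ _ _ _ _ = split_map (phi x) (F x) (gamma_rho rho lambda)
  (sigma_rho rho lambda)); last by apply/funext => v; rewrite simple_factorE.
exact: split_map_bij.
Qed.

(** A punctured neighbourhood of lambda can be shrunk to avoid both rho and conj rho. There the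
    gauged family equals one that is affine in mu, whose limit is its value at lambda, even where
    r_lambda is singular. *)
Lemma gauge_cvg lambda (s : S -> quat2 R) c x X : smooth_on setT s -> atlas c -> dom c x ->
  gauge (simple_factor rho E L mu) (assoc_family (assoc_form F fd) mu) s c x X
    @[mu --> lambda^'] --> assoc_family (eta_hat rho E L) lambda s c x X.
Proof.
move=> sm ac dx.
have neq r : \forall mu \near lambda^', mu != r :> cplx R.
  case: (eqVneq lambda r) => [<-|ne]; first exact: nbhs_dnbhs_neq.
  apply: nbhs_dnbhs; have FF : Filter (nbhs lambda) := nbhs_filter lambda.
  have e0 : 0 < `|lambda - r| by rewrite normr_gt0 subr_eq0.
  apply: (@filterS _ (nbhs lambda) FF _ _ _ (nbhsx_ballx lambda _ e0)) => mu.
  by rewrite -ball_normE /=; apply: contraTneq => ->; rewrite ltxx.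
have e : \forall mu \near lambda^', assoc_family (eta_hat rho E L) mu s c x X =
    gauge (simple_factor rho E L mu) (assoc_family (assoc_form F fd) mu) s c x X.
  by apply: filterS2 (neq rho) (neq (Num.conj rho)) => mu m1 m2; rewrite gaugeE.
apply: cvg_trans (near_eq_cvg e) _; rewrite /assoc_family.
apply: cvgD; first exact: cvg_cst.
by apply: cvg_rmul_c2q; exact: nbhs_dnbhs.
Qed.

End Darboux.

Theorem theorem3p11 (R : realType) (M Mt : riemann_surface R) (cov : Mt -> M)
    (f : M -> quat R) (fd : Mt -> quat R) (rho : cplx R) (phi : Mt -> quat2 R) :
  let eta := assoc_form (f \o cov) fd in
  let E := fun x => complex_line (phi x) in
  let L := line_bundle (f \o cov) in
  let r := simple_factor rho E L in
  let etah := eta_hat rho E L in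
  let Lh := darboux phi in
  universal_cover cov ->
  isothermic cov f ->
  dual_surface cov f fd ->
  rho != 0 ->
  parallel (assoc_family eta rho) phi ->
  splitting E L ->
  (forall x v, r lambda x v @[lambda --> @cinfty R] -->
     simple_factor_infty rho E L x v) /\
  (forall x, Lh x = range (simple_factor_infty rho E L x)) /\
  (forall lambda x, lambda != rho -> lambda != Num.conj rho ->
     bijective (r lambda x)) /\
  (forall lambda s, lambda != rho -> lambda != Num.conj rho ->
     smooth_on setT s ->
     eq_form (gauge (r lambda) (assoc_family eta lambda) s)
             (assoc_family etah lambda s)) /\
  (forall lambda s c x X, smooth_on setT s -> atlas c -> dom c x ->
     gauge (r mu) (assoc_family eta mu) s c x X @[mu --> lambda^'] -->
       assoc_family etah lambda s c x X) /\
  (forall s, smooth_on setT s ->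
     eq_form (eta_hat_op rho E L s) (fun c x X => etah c x X (s x))) /\
  associated_to Lh etah /\
  (forall fh : Mt -> quat R, (forall x, Lh x = line_bundle fh x) ->
     exists2 fhd, dual_surface id fh fhd & eq_form etah (assoc_form fh fhd)).
Proof.
move=> eta E L r etah Lh [hcov _] [hf _ _] [hfd w1 w2] rho0 [sphi par] spl.
have hF : branched_conformal (f \o cov) by exact: branched_conformal_cover.
have sF := hF.1; have sfd := hfd.1.
have a0 x : alpha (phi x) ((f \o cov) x) != 0 by exact: splitting_alpha (spl x).
split; first by move=> x v; rewrite simple_factor_inftyE//; exact: simple_factor_cvg.
split; first by move=> x; exact: darboux_range.
split; first by move=> lambda x l1 l2; exact: simple_factor_bij.
split.
  move=> lambda s l1 l2 sm c x X ac dx.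
  exact: (gaugeE sF sphi par rho0 a0 ac dx X l1 l2 sm).
split.
  move=> lambda s c x X sm ac dx.
  exact: (@gauge_cvg R Mt (f \o cov) fd rho phi
    sF sphi par rho0 a0 lambda s c x X sm ac dx).
split; first by move=> s sm; exact: (eta_hat_op_order0 sF sphi par a0 sm).
split; first exact: (eta_hat_associated sF sphi par rho0 a0 w1 w2 hF hfd).
move=> fh hfh; exists (dual_darboux (f \o cov) fd rho phi).
  exact: (dual_darboux_dual sF sfd sphi par rho0 a0 w1 w2 hF hfh).
exact: (eta_hat_assoc sF sfd sphi par rho0 a0 hfh).
Qed.
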